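(* (In ZFC.) For every valuation domain $R$ of cardinality $\aleph_1$ and every type $J/R$, if $\Gamma(J/R)=1$, then there is a non-standard uniserial $R$-module of type $J/R$.
   Context: A valuation domain is an integral domain whose ideals are linearly ordered; $Q$ its quotient field. A module is uniserial if its submodules are linearly ordered; a uniserial $R$-module is standard if isomorphic to $J'/A$ for $R$-submodules $A\subseteq J'$ of $Q$, non-standard otherwise. For uniserial $U$ and $0\neq a\in U$, $\mathrm{Ann}(a)=\{r:ra=0\}$, $D(a)=\bigcup\{r^{-1}R:a\in rU\}$; $U$ has type $J/A$ if $J/A\cong D(a)/\mathrm{Ann}(a)$. A type $J/R$ is given by an $R$-submodule $J$ of $Q$ with $R\subseteq J$; write $J=\bigcup_{\sigma<\omega_1} r_\sigma^{-1}R$ with nonzero $r_\sigma\in R$, $r_\tau\mid r_\sigma$ for $\tau<\sigma$. A cub is a closed unbounded subset of $\omega_1$; $D(\omega_1)$ is ${\cal P}(\omega_1)$ modulo $S_1\sim S_2$ iff $S_1\cap C=S_2\cap C$ for some cub $C$, a Boolean algebra whose $0$ is the class of sets disjoint from a cub and whose $1$ is the class of sets containing a cub. $\Gamma(J/R)$ is the class of $S=\{\delta<\omega_1\text{ limit}: R/\bigcap_{\sigma<\delta}r_\sigma R\text{ is not complete}\}$, where $R/\bigcap_{\sigma<\delta}r_\sigma R$ carries the metrizable linear topology with basis of neighbourhoods of $0$ given by the images of $r_\sigma R$, $\sigma<\delta$. This is independent of the choice of the $r_\sigma$. *)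

(* Defs.v *)
From HB Require Import structures.
From mathcomp Require Import all_boot all_order all_algebra fraction.
Set Implicit Arguments. Unset Strict Implicit. Unset Printing Implicit Defensive.
Import Order.TTheory GRing.Theory Num.Theory.
Local Open Scope ring_scope.

Section Defs.
Variable R : idomainType.

Definition QF := {fraction R}.
Definition emb (r : R) : QF := @FracField.tofrac R r.

Definition is_ideal (I : R -> Prop) : Prop :=
  I 0 /\ (forall x y, I x -> I y -> I (x + y)) /\ (forall r x, I x -> I (r * x)).

Definition valuation_domain : Prop :=
  forall I K : R -> Prop, is_ideal I -> is_ideal K ->
    (forall x, I x -> K x) \/ (forall x, K x -> I x).

Definition Qsubmod (A : QF -> Prop) : Prop :=
  A 0 /\ (forall x y, A x -> A y -> A (x + y)) /\
  (forall (r : R) x, A x -> A (emb r * x)).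

Definition RinQ (x : QF) : Prop := exists s : R, x = emb s.

Definition submod (U : lmodType R) (V : U -> Prop) : Prop :=
  V 0 /\ (forall x y, V x -> V y -> V (x + y)) /\ (forall (r : R) x, V x -> V (r *: x)).

Definition uniserial (U : lmodType R) : Prop :=
  forall V W : U -> Prop, submod V -> submod W ->
    (forall x, V x -> W x) \/ (forall x, W x -> V x).

(* J1/A1 ~= J2/A2 for submodules A1 <= J1, A2 <= J2 of Q, encoded by the
   graph phi = {(x,y) | g [x] = [y]} of an isomorphism g *)
Definition quot_iso (J1 A1 J2 A2 : QF -> Prop) : Prop :=
  exists phi : QF -> QF -> Prop,
    (forall x y, phi x y -> J1 x /\ J2 y) /\
    phi 0 0 /\
    (forall x y x' y', phi x y -> phi x' y' -> phi (x + x') (y + y')) /\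
    (forall (r : R) x y, phi x y -> phi (emb r * x) (emb r * y)) /\
    (forall x, J1 x -> exists y, phi x y) /\
    (forall y, J2 y -> exists x, phi x y) /\
    (forall x y, phi x y -> (A1 x <-> A2 y)).

(* U ~= J'/A, encoded by the graph of the composite J' -> J'/A ~= U *)
Definition iso_to_quot (U : lmodType R) (J' A : QF -> Prop) : Prop :=
  exists phi : QF -> U -> Prop,
    (forall x u, phi x u -> J' x) /\
    phi 0 0 /\
    (forall x u x' u', phi x u -> phi x' u' -> phi (x + x') (u + u')) /\
    (forall (r : R) x u, phi x u -> phi (emb r * x) (r *: u)) /\
    (forall x, J' x -> exists u, phi x u) /\
    (forall u, exists x, phi x u) /\
    (forall x u, phi x u -> (A x <-> u = 0)).

Definition standard (U : lmodType R) : Prop :=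
  exists A J' : QF -> Prop, Qsubmod A /\ Qsubmod J' /\
    (forall x, A x -> J' x) /\ iso_to_quot U J' A.

Definition Ann (U : lmodType R) (a : U) (x : QF) : Prop :=
  exists s : R, x = emb s /\ s *: a = 0.

Definition Dset (U : lmodType R) (a : U) (x : QF) : Prop :=
  exists (r : R) (s : R), r != 0 /\ (exists u : U, a = r *: u) /\ x = emb s / emb r.

Definition has_type (U : lmodType R) (J A : QF -> Prop) : Prop :=
  forall a : U, a != 0 -> quot_iso J A (Dset a) (Ann a).

End Defs.

Definition is_omega1 (W : Type) (lt : W -> W -> Prop) : Prop :=
  (forall x, ~ lt x x) /\
  (forall x y z, lt x y -> lt y z -> lt x z) /\
  (forall x y, lt x y \/ x = y \/ lt y x) /\
  well_founded lt /\
  inhabited W /\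
  (~ exists f : nat -> W, forall w, exists n, f n = w) /\
  (forall s : W, exists f : nat -> W, forall t, lt t s -> exists n, f n = t).

Section Omega1.
Variables (W : Type) (lt : W -> W -> Prop).

Definition is_limit (d : W) : Prop :=
  (exists t, lt t d) /\ (forall t, lt t d -> exists t', lt t t' /\ lt t' d).

Definition cub (C : W -> Prop) : Prop :=
  (forall s, exists d, C d /\ lt s d) /\
  (forall d, is_limit d ->
     (forall t, lt t d -> exists c, C c /\ lt t c /\ lt c d) -> C d).

Variable R : idomainType.
Variable r : W -> R.

Definition inrR (s : W) (x : R) : Prop := exists c : R, x = c * r s.

(* completeness of R / \bigcap_{sigma < delta} r_sigma R in the linear
   topology with basis of neighbourhoods of 0 the images of r_sigma R,
   sigma < delta; being first countable, completeness = sequential. *)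
Definition cauchy_below (d : W) (u : nat -> R) : Prop :=
  forall s, lt s d -> exists N, forall m n, (N <= m)%N -> (N <= n)%N ->
    inrR s (u m - u n).

Definition converges_below (d : W) (u : nat -> R) (x : R) : Prop :=
  forall s, lt s d -> exists N, forall n, (N <= n)%N -> inrR s (u n - x).

Definition complete_below (d : W) : Prop :=
  forall u : nat -> R, cauchy_below d u -> exists x, converges_below d u x.

(* the set S whose class in D(omega_1) is Gamma(J/R) *)
Definition Gamma_set (d : W) : Prop := is_limit d /\ ~ complete_below d.

(* Gamma(J/R) = 1 in D(omega_1): S contains a cub *)
Definition Gamma_is_one : Prop := exists C, cub C /\ forall d, C d -> Gamma_set d.

End Omega1.

Definition presents (W : Type) (lt : W -> W -> Prop) (R : idomainType)
  (r : W -> R) (J : QF R -> Prop) : Prop :=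
  (forall s, r s != 0) /\
  (forall t s, lt t s -> exists c : R, r s = c * r t) /\
  (forall x, J x <-> exists s (a : R), x = emb a / emb (r s)).

(* Main.v *)
Require Import Defs.
From HB Require Import structures.
From mathcomp Require Import all_boot all_order all_algebra fraction.
From mathcomp Require Import generic_quotient ring boolp functions.
Set Implicit Arguments. Unset Strict Implicit. Unset Printing Implicit Defensive.
Import GRing.Theory.
Local Open Scope ring_scope.

(** A uniserial module of type J/R is a direct limit of copies R a_s of R/r_s R
    with a_t = e_s^t (r_s/r_t) a_s, where the units e_s^t satisfy
    e_s^u = e_s^t e_t^u modulo r_u; it is standard exactly when there are units
    c_s with c_t = e_s^t c_s modulo r_t.  So one wants a coherent system without
    such a trivialization, that is, a tree with levels (R/r_s R)^* and no cofinal
    branch.  At a limit d the system below d extends, and may be multiplied by any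
    Cauchy family of units.

    Under CH, at each d where R is incomplete two extensions differing by a
    nonconvergent family are available; a trivialization below d is compatible with
    at most one of them, and the Devlin-Shelah weak diamond argument (2^aleph_0 <
    2^aleph_1) shows that some sequence of choices defeats all trivializations.

    Without CH, suppose first that the quotients (1 + r_s R)/(1 + r_t R) are
    uncountable for unboundedly many t above every s.  Filter R by countable sets
    R_d.  Since 2^aleph_0 exceeds |R|, e_d can be chosen so that no unit u has all
    e_d^t u in R_d modulo r_t; a trivialization c would violate this at a d
    closed under s |-> c_s.

    Otherwise all levels may be taken countable, and the system is built like a
    special Aronszajn tree: with the nodes of each level enumerated, for every
    node of limit level d and every n, the successor levels at which its
    predecessor is among the first n nodes are bounded below d. *)

(** * Recursion and closure points along omega_1 *)

Lemma dependent_choice_nat (X : Type) (I : nat -> X -> Prop)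
    (P : nat -> X -> X -> Prop) (x0 : X) :
  I 0%N x0 ->
  (forall n x, I n x -> exists y, I n.+1 y /\ P n x y) ->
  exists f : nat -> X, f 0%N = x0 /\ forall n, I n (f n) /\ P n (f n) (f n.+1).
Proof.
move=> I0 step.
have [g gP] : {g : nat -> X -> X & forall n x, I n x -> I n.+1 (g n x) /\ P n x (g n x)}.
  have /choice [h hP] : forall nx : nat * X, exists y,
      I nx.1 nx.2 -> I nx.1.+1 y /\ P nx.1 nx.2 y.
    move=> [n x] /=; case: (pselect (I n x)) => [/step[y yP]|nI]; first by exists y.
    by exists x => /nI.
  by exists (fun n x => h (n, x)) => n x; exact: (hP (n, x)).
pose f := fix f n := if n is m.+1 then g m (f m) else x0.
have fI n : I n (f n) by elim: n => //= n /gP[].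
by exists f; split => // n; split => //; have /gP[] := fI n.
Qed.

Section Omega1.
Variables (W : Type) (lt : W -> W -> Prop).
Hypothesis om : is_omega1 lt.

Definition wle (x y : W) := lt x y \/ x = y.

Lemma wlt_irr x : ~ lt x x.
Proof. by case: om => h _; exact: h. Qed.

Lemma wlt_trans x y z : lt x y -> lt y z -> lt x z.
Proof. by case: om => _ [h _]; exact: h. Qed.

Lemma wlt_total x y : lt x y \/ x = y \/ lt y x.
Proof. by case: om => _ [_ [h _]]; exact: h. Qed.

Lemma wlt_wf : well_founded lt.
Proof. by case: om => _ [_ [_ [h _]]]. Qed.

Lemma w_inh : inhabited W.
Proof. by case: om => _ [_ [_ [_ [h _]]]]. Qed.

Lemma wlt_seg s : exists f : nat -> W, forall t, lt t s -> exists n, f n = t.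
Proof. by case: om => _ [_ [_ [_ [_ [_ h]]]]]; exact: h. Qed.

Lemma wle_lt_trans x y z : wle x y -> lt y z -> lt x z.
Proof. by case=> [|->//]; exact: wlt_trans. Qed.

Lemma wlt_le_trans x y z : lt x y -> wle y z -> lt x z.
Proof. by move=> xy [yz|<-//]; exact: (wlt_trans xy yz). Qed.

Lemma wle_trans x y z : wle x y -> wle y z -> wle x z.
Proof. by move=> xy [yz|<-//]; left; exact: (wle_lt_trans xy yz). Qed.

Lemma wle_refl x : wle x x. Proof. by right. Qed.

Lemma wltNge x y : lt x y -> ~ wle y x.
Proof. by move=> xy [yx|yx]; [apply: (@wlt_irr x (wlt_trans xy yx))|subst y; exact: wlt_irr xy]. Qed.

Lemma wleNgt x y : ~ lt x y -> wle y x.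
Proof. by case: (wlt_total x y) => [//|[->|]]; [right|left]. Qed.

Lemma wlt_or_ge x y : lt x y \/ wle y x.
Proof. by case: (wlt_total x y) => [|[->|]]; [left|right; right|right; left]. Qed.

Lemma wlt_min (P : W -> Prop) : (exists x, P x) ->
  exists x, P x /\ forall y, lt y x -> ~ P y.
Proof.
move=> [x Px]; apply: contrapT => nmin.
move: x Px; apply: (well_founded_ind wlt_wf) => x IH Px.
by apply: nmin; exists x; split => // y /IH.
Qed.

(** Without a strict bound, [W] would be a countable union of countable closed initial segments. *)
Lemma wsup_seq (f : nat -> W) : exists b, forall n, lt (f n) b.
Proof.
apply: contrapT => nb.
have /choice[F FP] : forall s : W, exists g : nat -> W,
    forall t, lt t s -> exists n, g n = t by exact: wlt_seg.
case: om => _ [_ [_ [_ [_ [unc _]]]]]; apply: unc.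
exists (fun k => match unpickle k : option (nat * option nat) with
  | Some (n, Some m) => F (f n) m | Some (n, None) => f n | None => f 0%N end) => w.
have [n /wleNgt nw] : exists n, ~ lt (f n) w.
  by apply: contrapT => h; apply: nb; exists w => n; apply: contrapT => h'; apply: h; exists n.
case: nw => [/FP[m]|->].
  by move=> <-; exists (pickle (n, Some m)); rewrite pickleK.
by exists (pickle (n, None : option nat)); rewrite pickleK.
Qed.

Lemma wsup2 x y : exists b, lt x b /\ lt y b.
Proof.
have [b bP] := wsup_seq (fun n => if n is 0%N then x else y).
by exists b; split; [exact: (bP 0%N)|exact: (bP 1%N)].
Qed.

Lemma wsup_below s (F : W -> W) : exists b, forall t, lt t s -> lt (F t) b.
Proof.
have [f fP] := wlt_seg s; have [b bP] := wsup_seq (F \o f).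
by exists b => t /fP[n <-]; exact: bP.
Qed.

Lemma wmax x y : exists m, wle x m /\ wle y m /\ (m = x \/ m = y).
Proof.
case: (wlt_or_ge x y) => h; first by exists y; split; [left|split; [right|right]].
by exists x; split; [right|split=> //; left].
Qed.

Lemma seg_enum d : (exists t, lt t d) -> exists q : nat -> W,
  (forall n, lt (q n) d) /\ forall t, lt t d -> exists n, q n = t.
Proof.
move=> [t0 t0d]; have [f fP] := wlt_seg d.
exists (fun n => if pselect (lt (f n) d) then f n else t0); split=> [n|t td].
  by case: pselect.
by have [n fn] := fP _ td; exists n; rewrite fn; case: pselect.
Qed.

Lemma wlimit_cases d : (forall t, ~ lt t d) \/
  (exists t, lt t d /\ forall s, lt s d -> wle s t) \/ is_limit lt d.
Proof.
case: (pselect (exists t, lt t d)) => [ex|nex]; last first.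
  by left=> t td; apply: nex; exists t.
right; case: (pselect (exists t, lt t d /\ forall s, lt s d -> wle s t)) => [|nm].
  by left.
right; split=> // t td; apply: contrapT => nt; apply: nm; exists t; split=> // s sd.
by apply: wleNgt => ts; apply: nt; exists s.
Qed.

(** The point [d] is the supremum of a sequence in which each term bounds all values [F n t] with
    [t] at most the preceding term. *)
Lemma closure_point (F : nat -> W -> W) (s0 : W) : exists d, is_limit lt d /\
  lt s0 d /\ forall t, lt t d -> forall n, lt (F n t) d.
Proof.
have stp (m : W) : exists m', lt m m' /\ forall t, wle t m -> forall n, lt (F n t) m'.
  have /choice[b bP] : forall t, exists b, forall n, lt (F n t) b.
    by move=> t; exact: wsup_seq.
  have [c cP] := wsup_below m b; have [c1 [cc1 mc1]] := wsup2 c m.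
  have [c2 [c12 bc2]] := wsup2 c1 (b m).
  exists c2; split=> [|t]; first exact: wlt_trans mc1 c12.
  case=> [tm n|-> n]; last exact: wlt_trans (bP m n) bc2.
  exact: wlt_trans (wlt_trans (wlt_trans (bP t n) (cP _ tm)) cc1) c12.
have [t [t0 /all_and2[_ tP]]] := @dependent_choice_nat W (fun _ _ => True)
  (fun _ m m' => lt m m' /\ forall t, wle t m -> forall n, lt (F n t) m') s0
  I (fun _ m _ => let: ex_intro m' h := stp m in ex_intro _ m' (conj I h)).
have [d [td dmin]] := wlt_min (wsup_seq t).
have cof s : lt s d -> exists n, wle s (t n).
  move=> sd; apply: contrapT => nn; apply: (dmin _ sd) => n.
  by case: (wlt_or_ge (t n) s) => // h; case: nn; exists n.
exists d; split; first split; last split.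
- by exists (t 0%N).
- by move=> s /cof[n sn]; exists (t n.+1); split => //; have [h _] := tP n; exact: wle_lt_trans h.
- by rewrite -t0.
- by move=> s /cof[n sn] k; have [_ /(_ _ sn k) h] := tP n; exact: wlt_trans h _.
Qed.

(** When [q] enumerates the points below [d], the sequence [t] is cofinal in [d]. The step
    hypothesis covers all [s] at most [m] because [t n] is first raised to at least [q n.+1]. *)
Lemma increasing_seq d (P : W -> W -> Prop) (q : nat -> W) :
  (forall n, lt (q n) d) ->
  (forall m, lt m d -> exists m', lt m m' /\ lt m' d /\ forall s, wle s m -> P s m') ->
  exists t : nat -> W, forall n,
    [/\ lt (t n) d, lt (q n) (t n), lt (t n) (t n.+1) & P (t n) (t n.+1)].
Proof.
move=> qd stp.
have [t0 [qt0 [t0d _]]] := stp _ (qd 0%N).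
have [|t [_ tP]] := @dependent_choice_nat W
    (fun n m => lt m d /\ lt (q n) m) (fun _ m m' => lt m m' /\ P m m') t0 (conj t0d qt0).
  move=> n m [md qm]; have [k [mk [qk kE]]] := wmax m (q n.+1).
  have kd : lt k d by case: kE => ->.
  have [m' [km' [m'd Pm']]] := stp _ kd.
  exists m'; split; split=> //; [exact: wle_lt_trans qk km'|exact: wle_lt_trans mk km'|exact: Pm'].
by exists t => n; have [[h1 h2] [h3 h4]] := tP n.
Qed.

Lemma seq_mono (t : nat -> W) : (forall n, lt (t n) (t n.+1)) ->
  forall m n, (m <= n)%N -> wle (t m) (t n).
Proof.
move=> tP m n; elim: n => [|n IH]; first by rewrite leqn0 => /eqP->; right.
rewrite leq_eqVlt => /orP[/eqP->|]; first by right.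
by rewrite ltnS => /IH h; left; exact: wle_lt_trans h (tP n).
Qed.

(** The history is kept as a total function, so that histories agreeing below [s] become equal. *)
Definition restr (X : Type) (x0 : X) (s : W) (e : W -> X) : W -> X :=
  fun t => if pselect (lt t s) then e t else x0.

Lemma restr_lt (X : Type) (x0 : X) s e t : lt t s -> restr x0 s e t = e t.
Proof. by rewrite /restr; case: pselect. Qed.

Lemma restr_eq (X : Type) (x0 : X) s (e e' : W -> X) :
  (forall t, lt t s -> e t = e' t) -> restr x0 s e = restr x0 s e'.
Proof. by move=> ee'; apply: funext => t; rewrite /restr; case: pselect => // p; exact: ee'. Qed.

Lemma wrec (X : Type) (x0 : X) (F : W -> (W -> X) -> X) :
  exists e : W -> X, forall s, e s = F s (restr x0 s e).
Proof.
pose G s (h : forall t, lt t s -> X) :=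
  F s (fun t => match pselect (lt t s) with left p => h t p | right _ => x0 end).
have Gext s (f g : forall t, lt t s -> X) : (forall t p, f t p = g t p) -> G s f = G s g.
  by move=> fg; congr (F s _); apply: funext => t; case: pselect.
exists (Fix wlt_wf (fun _ => X) G) => s; rewrite Fix_eq //.
by congr (F s _); apply: funext => t; rewrite /restr; case: pselect.
Qed.

Lemma wrec_choice (X : Type) (x0 : X) (Good : W -> (W -> X) -> X -> Prop) :
  (forall s e e' x, (forall t, lt t s -> e t = e' t) -> Good s e x -> Good s e' x) ->
  (forall s e, (forall t, lt t s -> Good t e (e t)) -> exists x, Good s e x) ->
  exists e, forall s, Good s e (e s).
Proof.
move=> loc ex.
have /choice[c cP] : forall p : W * (W -> X), exists x,
    (exists y, Good p.1 p.2 y) -> Good p.1 p.2 x.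
  move=> p; case: (pselect (exists y, Good p.1 p.2 y)) => [[y yP]|n]; first by exists y.
  by exists x0.
have [e eE] := wrec x0 (fun s h => c (s, h)).
exists e; apply: (well_founded_ind wlt_wf) => s IH.
have res t : lt t s -> restr x0 s e t = e t by exact: restr_lt.
apply: (loc _ (restr x0 s e)) => //; rewrite eE; apply: (cP (s, _)) => /=; apply: ex => t ts.
rewrite (res _ ts); apply: (loc _ e); last exact: IH.
by move=> u ut; rewrite res //; exact: wlt_trans ut ts.
Qed.

(** Only countably many values precede stage [s], so some point of [X] lies beyond all of them and
    beyond their thresholds for [Q]. *)
Lemma thinning (X : W -> Prop) (Q : W -> W -> Prop) :
  (forall s, exists t, X t /\ lt s t) ->
  (forall s, exists b, forall t, lt b t -> Q s t) ->
  exists phi : W -> W, forall s,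
    X (phi s) /\ forall t, lt t s -> lt (phi t) (phi s) /\ Q (phi t) (phi s).
Proof.
move=> unb ev; have [w0] := w_inh.
apply: (@wrec_choice W w0 (fun s e x =>
  X x /\ forall t, lt t s -> lt (e t) x /\ Q (e t) x)) => [s e e' x ee' [Xx h]|s e _].
  by split=> // t ts; rewrite -ee' //; exact: h.
have /choice[b bP] := ev.
have [c cP] := wsup_below s e; have [c' c'P] := wsup_below s (b \o e).
have [c2 [cc2 c'c2]] := wsup2 c c'.
have [x [Xx c2x]] := unb c2.
exists x; split=> // t ts; split.
  exact: wlt_trans (wlt_trans (cP _ ts) cc2) c2x.
apply: bP; exact: wlt_trans (wlt_trans (c'P _ ts) c'c2) c2x.
Qed.

Lemma increasing_ge (phi : W -> W) :
  (forall s t, lt t s -> lt (phi t) (phi s)) -> forall s, wle s (phi s).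
Proof.
move=> inc; apply: (well_founded_ind wlt_wf) => s IH; apply: wleNgt => h.
have := IH _ h; apply: wltNge; exact: inc.
Qed.

End Omega1.

(** * Congruences and coherent systems of units *)

Section Congruence.
Variable R : idomainType.

Definition eqm (a x y : R) : Prop := exists c, x - y = c * a.

Lemma eqm_refl a x : eqm a x x.
Proof. by exists 0; rewrite subrr mul0r. Qed.

Lemma eqm_sym a x y : eqm a x y -> eqm a y x.
Proof. by case=> c E; exists (- c); rewrite mulNr -E opprB. Qed.

Lemma eqm_trans a y x z : eqm a x y -> eqm a y z -> eqm a x z.
Proof. by case=> c E [d F]; exists (c + d); rewrite mulrDl -E -F; ring. Qed.

Lemma eqm_mul a x y x' y' : eqm a x x' -> eqm a y y' -> eqm a (x * y) (x' * y').
Proof.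
case=> c E [d F]; exists (c * y + x' * d).
by rewrite mulrDl mulrAC -E -mulrA -F; ring.
Qed.

Lemma eqm_mull a z x y : eqm a x y -> eqm a (z * x) (z * y).
Proof. exact/eqm_mul/eqm_refl. Qed.

Lemma eqm_mulr a z x y : eqm a x y -> eqm a (x * z) (y * z).
Proof. by move/eqm_mul; apply; exact: eqm_refl. Qed.

Lemma eqm_dvd a b x y : (exists c, b = c * a) -> eqm b x y -> eqm a x y.
Proof. by case=> c -> [d E]; exists (d * c); rewrite E mulrA. Qed.

Lemma eqm_unit a x y : a \is a GRing.unit -> eqm a x y.
Proof. by move=> ua; exists ((x - y) / a); rewrite divrK. Qed.

Lemma eqm_cancel a z x y : z \is a GRing.unit -> eqm a (z * x) (z * y) -> eqm a x y.
Proof. by move=> uz /(eqm_mull z^-1); rewrite !mulKr. Qed.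

Lemma eqm_inv a x : x \is a GRing.unit -> eqm a x 1 -> eqm a x^-1 1.
Proof. by move=> ux /(eqm_mull x^-1); rewrite mulVr // mulr1 => /eqm_sym. Qed.

Lemma valuation_dvd : valuation_domain R -> forall x y : R,
  (exists c, y = c * x) \/ (exists c, x = c * y).
Proof.
move=> val x y.
have idl z : is_ideal (fun t : R => exists c, t = c * z).
  split; first by exists 0; rewrite mul0r.
  split=> [u v [c ->] [d ->]|s u [c ->]]; first by exists (c + d); rewrite mulrDl.
  by exists (s * c); rewrite mulrA.
case: (val _ _ (idl x) (idl y)) => h; [right; apply: h|left; apply: h];
  by exists 1; rewrite mul1r.
Qed.

(** Whichever of [a] and [y] divides the other also divides the unit [x = y + c * a]; it cannot be
    [a]. *)
Lemma eqm_nonunit a x y : valuation_domain R -> a \isn't a GRing.unit ->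
  x \is a GRing.unit -> eqm a x y -> y \is a GRing.unit.
Proof.
move=> val na ux [c E].
have {E} E : x = y + c * a by rewrite -E; ring.
case: (valuation_dvd val a y) => [[k yE]|[k aE]].
  by move: ux; rewrite E yE -mulrDl unitrM (negPf na) andbF.
by move: ux; rewrite E aE mulrA -[X in X + _]mul1r -mulrDl unitrM => /andP[].
Qed.

End Congruence.

Section Systems.
Variables (W : Type) (lt : W -> W -> Prop).
Hypothesis om : is_omega1 lt.
Variables (R : idomainType) (r : W -> R).
Hypothesis rdvd : forall t s, lt t s -> exists c : R, r s = c * r t.

Lemma eqm_le s t x y : wle lt s t -> eqm (r t) x y -> eqm (r s) x y.
Proof. by case=> [/rdvd/eqm_dvd|->//]; exact. Qed.

(* The values e s t (t < s) are the units linking the generators a_t of a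
   twisted direct limit: a_t = e s t * (r s / r t) * a_s. *)
Definition coherent (e : W -> W -> R) : Prop :=
  (forall t s, lt t s -> e s t \is a GRing.unit) /\
  (forall u t s, lt u t -> lt t s -> eqm (r u) (e s u) (e s t * e t u)).

Definition trivial_system (e : W -> W -> R) : Prop := exists d : W -> R,
  (forall s, d s \is a GRing.unit) /\
  (forall t s, lt t s -> eqm (r t) (d t) (e s t * d s)).

(** Rows of a system take values in such a group: all units or, for countable levels, the units
    congruent to 1 modulo a fixed element. *)
Definition unit_subgroup (K : R -> Prop) : Prop :=
  [/\ K 1, forall x y, K x -> K y -> K (x * y), forall x, K x -> K x^-1
    & forall x, K x -> x \is a GRing.unit].

Section Branches.
Variable K : R -> Prop.
Hypothesis subK : unit_subgroup K.

(** A candidate for the row [e d] over the rows below [d]. The value 1 at [d] lets level [d] be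
    treated like the levels below it. *)
Definition branch (d : W) (e : W -> W -> R) (t : W -> R) : Prop :=
  [/\ t d = 1, forall s, lt s d -> K (t s)
    & forall u s, lt u s -> lt s d -> eqm (r u) (t u) (t s * e s u)].

(** Multiplication by such a Cauchy family turns one branch into another. *)
Definition conv_below (d : W) (b : W -> R) : Prop :=
  (forall s, lt s d -> K (b s)) /\
  (forall u s, lt u s -> lt s d -> eqm (r u) (b u) (b s)).

Lemma branch_local d e e' t : (forall s, lt s d -> e s = e' s) ->
  branch d e t -> branch d e' t.
Proof. by move=> ee' [t1 tK tc]; split=> // u s us sd; rewrite -ee' //; exact: tc. Qed.

Lemma branch_coherent e : (forall s, branch s e (e s)) -> coherent e.
Proof.
case: subK => _ _ _ Ku he; split=> [t s ts|u t s ut ts]; have [_ eK ec] := he s.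
  exact/Ku/eK.
exact: ec.
Qed.

Lemma branch_normalize d e t : (forall s, lt s d -> K (t s)) ->
  (forall u s, lt u s -> lt s d -> eqm (r u) (t u) (t s * e s u)) ->
  exists t', branch d e t' /\ forall s, lt s d -> t' s = t s.
Proof.
move=> tK tc; exists (fun s => if pselect (lt s d) then t s else 1).
split=> [|s sd]; last by case: pselect.
split=> [|s sd|u s us sd]; first by case: pselect => // p; case: (wlt_irr om p).
  by case: pselect => // p; exact: tK.
case: pselect => [p|np]; last by case: np; exact: (wlt_trans om us sd).
by case: pselect => // p'; exact: tc.
Qed.

Lemma branch_mul d e t b : branch d e t -> conv_below d b ->
  exists t', branch d e t' /\ forall s, lt s d -> t' s = t s * b s.
Proof.
case: subK => _ KM _ _ [_ tK tc] [bK bc]; apply: branch_normalize => [s sd|u s us sd].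
  by apply: KM; [exact: tK|exact: bK].
rewrite mulrAC; apply: eqm_mul; [exact: tc|exact: bc].
Qed.

(** The value at [s] is read off at any index [n] with [s] at most [t n]; modulo [r s] the index
    does not matter. *)
Lemma conv_of_seq d (t : nat -> W) (b : nat -> R) :
  (forall n, lt (t n) d) -> (forall n, lt (t n) (t n.+1)) ->
  (forall s, lt s d -> exists n, wle lt s (t n)) ->
  (forall n, K (b n)) -> (forall n, eqm (r (t n)) (b n.+1) (b n)) ->
  exists b', conv_below d b' /\
    forall n s, wle lt s (t n) -> eqm (r s) (b' s) (b n).
Proof.
move=> td tinc cof bK bc.
have far n m : (n <= m)%N -> eqm (r (t n)) (b m) (b n).
  elim: m => [|m IH]; first by rewrite leqn0 => /eqP->; exact: eqm_refl.
  rewrite leq_eqVlt => /orP[/eqP->|]; first exact: eqm_refl.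
  rewrite ltnS => nm; apply: eqm_trans (IH nm).
  exact: eqm_le (seq_mono om tinc nm) (bc m).
have /choice[N NP] : forall s, exists n, lt s d -> wle lt s (t n).
  move=> s; case: (pselect (lt s d)) => [/cof[n sn]|]; first by exists n.
  by exists 0%N.
have key n s : wle lt s (t n) -> eqm (r s) (b (N s)) (b n).
  move=> sn; have sd := wle_lt_trans om sn (td n).
  case: (leqP n (N s)) => h; first exact: eqm_le sn (far _ _ h).
  by apply: eqm_sym; apply: eqm_le (NP _ sd) (far _ _ (ltnW h)).
exists (fun s => b (N s)); split; last exact: key.
split=> [s _|u s us sd]; first exact: bK.
by apply: key; exact: (wle_trans om (or_introl us) (NP _ sd)).
Qed.

(** If [d] has an immediate predecessor [m], the row of [m] serves again; at a limit, multiples of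
    the rows along a cofinal sequence are glued. *)
Lemma branch_exists d e : (forall s, lt s d -> branch s e (e s)) ->
  exists t, branch d e t.
Proof.
case: (subK) => K1 KM KV Ku he.
case: (wlimit_cases om d) => [zero|[[m [md mmax]]|lim]].
- by exists (fun=> 1); split=> // u s _ sd; case: (zero s).
- have [e1 eK ec] := he m md.
  have [t [tB _]] : exists t, branch d e t /\ forall s, lt s d -> t s = e m s.
    apply: branch_normalize => [s /mmax[sm|->]|u s us /mmax[sm|->]].
    + exact: eK.
    + by rewrite e1.
    + exact: ec.
    + by rewrite e1 mul1r; exact: eqm_refl.
  by exists t.
have [q [qd qsurj]] := seg_enum om lim.1.
have [|t tP] := @increasing_seq _ lt om d (fun _ _ => True) q qd.
  by move=> m /lim.2[m' [mm' m'd]]; exists m'.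
(* These factors satisfy [s n.+1 * e (t n.+1) (t n) = s n], which makes the rows [s n * e (t n)]
   compatible. *)
pose s := fix s n := if n is k.+1 then s k / e (t k.+1) (t k) else 1.
have eK n u : lt u (t n) -> K (e (t n) u).
  by move=> ut; have [td _ _ _] := tP n; have [_ h _] := he _ td; exact: h.
have sK n : K (s n).
  elim: n => //= n IH; apply: KM => //; apply: KV; apply: eK; by have [] := tP n.
have cof u : lt u d -> exists n, lt u (t n).
  by move=> /qsurj[n <-]; exists n; have [] := tP n.
have tmono := @seq_mono _ lt om t (fun n => let: And4 _ _ h _ := tP n in h).
have step n u : lt u (t n) ->
    eqm (r u) (s n.+1 * e (t n.+1) u) (s n * e (t n) u).
  move=> un; have [td _ tt' _] := tP n; have [td' _ _ _] := tP n.+1.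
  have [_ _ h] := he _ td'; have ue := Ku _ (eK _ _ tt').
  have -> : s n * e (t n) u = s n.+1 * (e (t n.+1) (t n) * e (t n) u).
    by rewrite mulrA /= divrK.
  by apply: eqm_mull; exact: h.
have far n m u : (n <= m)%N -> lt u (t n) ->
    eqm (r u) (s m * e (t m) u) (s n * e (t n) u).
  elim: m => [|m IH]; first by rewrite leqn0 => /eqP-> _; exact: eqm_refl.
  rewrite leq_eqVlt => /orP[/eqP->|]; first by move=> _; exact: eqm_refl.
  rewrite ltnS => nm un; apply: eqm_trans (IH nm un); apply: step.
  exact: wlt_le_trans un (tmono _ _ nm).
have /choice[N NP] : forall u, exists n, lt u d -> lt u (t n).
  move=> u; case: (pselect (lt u d)) => [/cof[n un]|]; first by exists n.
  by exists 0%N.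
have [t' [tB _]] : exists t', branch d e t' /\
    forall u, lt u d -> t' u = s (N u) * e (t (N u)) u.
  apply: branch_normalize => [u ud|u v uv vd].
    by apply: KM => //; apply: eK; exact: NP.
  have vN := NP _ vd; have ud := wlt_trans om uv vd; have uN := NP _ ud.
  have uNv := wlt_trans om uv vN.
  have [td _ _ _] := tP (N v); have [_ _ h] := he _ td.
  rewrite -mulrA; apply: (@eqm_trans _ _ (s (N v) * e (t (N v)) u)); last first.
    by apply: eqm_mull; exact: h.
  case: (leqP (N u) (N v)) => Nuv; last exact: far (ltnW Nuv) uNv.
  by apply: eqm_sym; exact: far Nuv uN.
by exists t'.
Qed.

End Branches.

Lemma unit_unit_subgroup : unit_subgroup (fun x => x \is a GRing.unit).
Proof. by split=> [|x y ux uy|x|//]; rewrite ?unitr1 ?unitrM ?ux ?unitrV. Qed.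

End Systems.

(** * The module attached to a coherent system *)

(** The quotient of [B] by [A] lives on chosen representatives of the classes; [p] is meaningful
    only on [B]. *)
Lemma subquotient_exists (R : idomainType) (V : lmodType R) (A B : V -> Prop) :
  submod A -> submod B -> exists (U : lmodType R) (p : V -> U),
  [/\ forall x y, B x -> B y -> p (x + y) = p x + p y,
      forall a x, B x -> p (a *: x) = a *: p x,
      forall u, exists x, B x /\ p x = u
    & forall x, B x -> (p x = 0 <-> A x)].
Proof.
move=> [A0 [AD AZ]] [B0 [BD BZ]].
have AN x : A x -> A (- x) by rewrite -scaleN1r; exact: AZ.
have BN x : B x -> B (- x) by rewrite -scaleN1r; exact: BZ.
pose eqA x y := A (x - y).
have eqA_sym x y : eqA x y -> eqA y x by rewrite /eqA => /AN; rewrite opprB.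
have eqA_trans y x z : eqA x y -> eqA y z -> eqA x z.
  by rewrite /eqA => xy yz; have := AD _ _ xy yz; rewrite addrA subrK.
have eqA_refl x : eqA x x by rewrite /eqA subrr.
have /choice[c0 c0P] : forall P : V -> Prop, exists x, (exists y, P y) -> P x.
  by move=> P; case: (pselect (exists y, P y)) => [[y Py]|]; [exists y|exists 0].
(* Congruent elements define the same predicate, hence receive the same representative. *)
pose c x := c0 (fun y => B y /\ eqA y x).
have cP x : B x -> B (c x) /\ eqA (c x) x
  by move=> Bx; apply: (c0P (fun y => B y /\ eqA y x)); exists x.
have cE x y : eqA x y -> c x = c y.
  move=> xy; congr c0; apply: funext => z; apply: propext.
  by split=> -[Bz h]; split=> //; [exact: eqA_trans xy|exact: eqA_trans (eqA_sym _ _ xy)].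
have cc x : B x -> c (c x) = c x by move=> /cP[_ /cE].
pose T := {x : V | B x /\ c x = x}.
have cT x : B x -> B (c x) /\ c (c x) = c x.
  by move=> Bx; have [Bc _] := cP _ Bx; split; [|exact: cc].
pose mk x (Bx : B x) : T := exist _ (c x) (cT x Bx).
have Tinj (u v : T) : sval u = sval v -> u = v.
  case: u v => [x hx] [y hy] /= xy; subst y; congr exist; exact: Prop_irrelevance.
have BT (u : T) : B (sval u) by case: u => x [].
have cval (u : T) : c (sval u) = sval u by case: u => x [].
have eqAD x x' y y' : eqA x x' -> eqA y y' -> eqA (x + y) (x' + y').
  by rewrite /eqA => h h'; have := AD _ _ h h'; rewrite opprD addrACA.
have eqAZ a x x' : eqA x x' -> eqA (a *: x) (a *: x').
  by rewrite /eqA -scalerBr; exact: AZ.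
pose add (u v : T) := mk _ (BD _ _ (BT u) (BT v)).
pose opp (u : T) := mk _ (BN _ (BT u)).
pose scl (a : R) (u : T) := mk _ (BZ a _ (BT u)).
pose zero := mk 0 B0.
have cAl x y : B x -> c (c x + y) = c (x + y).
  by move=> /cP[_ h]; apply: cE; exact: eqAD.
have cAr x y : B y -> c (x + c y) = c (x + y).
  by move=> /cP[_ h]; apply: cE; exact: eqAD.
have cZ a x : B x -> c (a *: c x) = c (a *: x).
  by move=> /cP[_ h]; apply: cE; exact: eqAZ.
have addA : associative add.
  by move=> u v w; apply: Tinj; rewrite /= cAr ?cAl ?addrA //; apply/BD; apply/BT.
have addC : commutative add by move=> u v; apply: Tinj; rewrite /= addrC.
have add0 : left_id zero add.
  by move=> u; apply: Tinj; rewrite /= cAl // add0r cval.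
have addN : left_inverse zero opp add.
  by move=> u; apply: Tinj; rewrite /= cAl ?addNr //; apply/BN/BT.
pose T1 : choiceType := HB.pack_for choiceType T (gen_eqMixin T) (gen_choiceMixin T).
pose T2 : zmodType := HB.pack_for zmodType T T1
  (@GRing.isZmodule.Build T1 zero opp add addA addC add0 addN).
have sclA a b (u : T2) : scl a (scl b u) = scl (a * b) u.
  by apply: Tinj; rewrite /= cZ ?scalerA //; apply/BZ/BT.
have scl1 : left_id 1 scl by move=> u; apply: Tinj; rewrite /= scale1r cval.
have sclDr : @right_distributive R T2 scl +%R.
  move=> a u v; apply: Tinj; rewrite /= cZ ?cAl ?cAr ?scalerDr //.
  - apply/BZ/BT.
  - apply/BZ/BT.
  - apply/BD; apply/BT.
have sclDl (v : T2) : {morph (scl^~ v : R -> T2) : a b / a + b}.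
  move=> a b; apply: Tinj; rewrite /= cAl ?cAr ?scalerDl //; apply/BZ/BT.
pose U : lmodType R := HB.pack_for (lmodType R) T T2
  (@GRing.Zmodule_isLmodule.Build R T2 scl sclA scl1 sclDr sclDl).
pose p x : T := match pselect (B x) with left Bx => mk x Bx | right _ => zero end.
have pE x : B x -> sval (p x) = c x by rewrite /p; case: pselect.
exists U, p; split.
- move=> x y Bx By; apply: Tinj; change (sval (p (x + y)) = c (sval (p x) + sval (p y))).
  by rewrite (pE _ (BD _ _ Bx By)) !pE // cAl // cAr.
- move=> a x Bx; apply: Tinj; change (sval (p (a *: x)) = c (a *: sval (p x))).
  by rewrite (pE _ (BZ a _ Bx)) pE // cZ.
- by move=> u; exists (sval u); split; [apply/BT|apply: Tinj; rewrite pE ?cval //; apply/BT].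
- move=> x Bx; have [_ cx] := cP _ Bx; have [_ c0'] := cP _ B0; split.
    move/(congr1 sval); rewrite pE //= => E.
    rewrite -[x]subr0; apply: eqA_trans c0'; rewrite -E; exact: eqA_sym.
  by move=> Ax; apply: Tinj; rewrite pE //=; apply: cE; rewrite /eqA subr0.
Qed.

Section TwistedLimit.
Variables (W : Type) (lt : W -> W -> Prop).
Hypothesis om : is_omega1 lt.
Variables (R : idomainType) (r : W -> R).
Hypothesis r0 : forall s, r s != 0.
Hypothesis rdvd : forall t s, lt t s -> exists c : R, r s = c * r t.

(* The direct limit is realised inside the product of copies of R indexed by W,
   modulo the families x with x_s in r_s R for all large s. *)
Lemma twisted_limit (e : W -> W -> R) : coherent lt r e ->
  exists (U : lmodType R) (a : W -> U),
  [/\ forall u, exists s x, u = x *: a s,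
      forall s x, x *: a s = 0 <-> exists c, x = c * r s
    & forall t s k, lt t s -> r s = k * r t -> a t = (e s t * k) *: a s].
Proof.
move=> [eu ec].
have /choice[q' q'P] : forall p : W * W, exists k, lt p.2 p.1 -> r p.1 = k * r p.2.
  by move=> [s t] /=; case: (pselect (lt t s)) => [/rdvd[k kE]|]; [exists k|exists 0].
pose q s t := q' (s, t).
have qP s t : lt t s -> r s = q s t * r t by exact: (q'P (s, t)).
have qM u t s : lt u t -> lt t s -> q s u = q s t * q t u.
  move=> ut ts; apply: (mulIf (r0 u)); rewrite -mulrA -!qP //; exact: (wlt_trans om ut ts).
(* [g t] stands for the generator [a t]: its coordinate at a later [s] is the coefficient of [a t]
   with respect to [a s]. *)
pose g t : W -> R^o := fun s => if pselect (lt t s) then e s t * q s t else 0.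
have gE t s : lt t s -> g t s = e s t * q s t by rewrite /g; case: pselect.
pose A (v : W -> R^o) := exists b, forall s, lt b s -> exists c : R, v s = c * r s.
have [w0] := w_inh om.
have Asub : submod A.
  split; first by exists w0 => s _; exists 0; rewrite mul0r.
  split=> [x y [b bP] [b' b'P]|a x [b bP]].
    have [b2 [h h']] := wsup2 om b b'; exists b2 => s b2s.
    have [c cE] := bP _ (wlt_trans om h b2s); have [c' c'E] := b'P _ (wlt_trans om h' b2s).
    by exists (c + c'); rewrite mulrDl -cE -c'E.
  by exists b => s /bP[c cE]; exists (a * c); rewrite -mulrA -cE.
have [A0 [AD AZ]] := Asub.
have up t s : lt t s -> A (g t - (e s t * q s t) *: g s).
  move=> ts; exists s => w sw; have tw := wlt_trans om ts sw.
  have [c cE] := ec _ _ _ ts sw.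
  exists c; change (g t w - (e s t * q s t) * g s w = c * r w).
  have -> : c * r w = (c * r t) * q w t by rewrite (qP w t) //; ring.
  by rewrite !gE // -cE (qM t s w) //; ring.
pose B (v : W -> R^o) := exists t x, A (v - x *: g t).
have Bup v t x s : A (v - x *: g t) -> lt t s -> exists y, A (v - y *: g s).
  move=> Av ts; exists (x * (e s t * q s t)).
  have -> : v - (x * (e s t * q s t)) *: g s =
      (v - x *: g t) + x *: (g t - (e s t * q s t) *: g s).
    by rewrite scalerBr scalerA addrA subrK.
  by apply: AD => //; apply: AZ; exact: up.
have Bsub : submod B.
  split; first by exists w0, 0; rewrite scale0r subr0.
  split=> [x y [t [a Ax]] [s [b Ay]]|a x [t [b Ax]]].
    have [w [tw sw]] := wsup2 om t s.
    have [a' Ax'] := Bup _ _ _ _ Ax tw; have [b' Ay'] := Bup _ _ _ _ Ay sw.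
    exists w, (a' + b'); rewrite scalerDl opprD addrACA; exact: AD.
  by exists t, (a * b); rewrite -scalerA -scalerBr; exact: AZ.
have [U [p [pD pZ psurj p0]]] := subquotient_exists Asub Bsub.
have Bg t : B (g t) by exists t, 1; rewrite scale1r subrr.
have BZ a v : B v -> B (a *: v) by case: Bsub => _ [_]; exact.
have peq v w : B v -> B w -> A (v - w) -> p v = p w.
  move=> Bv Bw Avw; apply/eqP; rewrite -subr_eq0 -scaleN1r -pZ // -pD //; last exact: BZ.
  apply/eqP/p0; last by rewrite scaleN1r.
  by case: Bsub => _ [h _]; apply: h => //; exact: BZ.
exists U, (fun t => p (g t)); split.
- move=> u; have [v [Bv <-]] := psurj u; have [t [x Av]] := Bv.
  by exists t, x; rewrite -pZ //; apply: peq => //; exact: BZ.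
- move=> s x; rewrite -pZ //; split.
    move/p0 => /(_ (BZ _ _ (Bg s)))[b bP].
    have [w [bw sw]] := wsup2 om b s; have [c] := bP _ bw.
    change (x * g s w = c * r w -> exists c, x = c * r s).
    rewrite gE // (qP w s) // => E.
    have qn0 : q w s != 0 by apply: contraNneq (r0 w) => q0; rewrite (qP w s) // q0 mul0r.
    have {}E : x * e w s = c * r s.
      by apply: (mulIf qn0); rewrite -[LHS]mulrA [LHS]E; ring.
    by exists (c / e w s); rewrite mulrAC -E mulrK //; exact: eu.
  case=> c ->; apply/p0; first exact: BZ.
  exists s => w sw; exists (c * e w s).
  by change ((c * r s) * g s w = c * e w s * r w); rewrite gE // (qP w s) //; ring.
- move=> t s k ts kE.
  have -> : k = q s t by apply: (mulIf (r0 t)); rewrite -kE -qP.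
  by rewrite -pZ //; apply: peq => //; [exact: BZ|exact: up].
Qed.

End TwistedLimit.

(** * The ring inside its quotient field *)

Section Embedding.
Local Open Scope quotient_scope.
Variable R : idomainType.
Implicit Types x y : R.

Lemma embM x y : emb (x * y) = emb x * emb y.
Proof. exact: rmorphM. Qed.

Lemma embD x y : emb (x + y) = emb x + emb y.
Proof. exact: rmorphD. Qed.

Lemma embN x : emb (- x) = - emb x.
Proof. exact: rmorphN. Qed.

Lemma embB x y : emb (x - y) = emb x - emb y.
Proof. exact: rmorphB. Qed.

Lemma emb_eq0 x : (emb x == 0) = (x == 0).
Proof. exact: tofrac_eq0. Qed.

Lemma emb_inj : injective (@emb R).
Proof. by move=> x y /eqP; rewrite tofrac_eq => /eqP. Qed.

Lemma emb0 : emb (0 : R) = 0. Proof. exact: rmorph0. Qed.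
Lemma emb1 : emb (1 : R) = 1. Proof. exact: rmorph1. Qed.

Lemma emb_frac (z : QF R) : exists x y, y != 0 /\ z = emb x / emb y.
Proof.
elim/quotW: z => z; exists (\n_z), (\d_z).
have d0 := denom_ratioP z; split=> //.
have e0 : emb (\d_z) != 0 by rewrite tofrac_eq0.
apply: (mulIf e0); rewrite divfK // /emb !piE.
apply/eqmodP; rewrite /= FracField.equivfE /FracField.mulf.
rewrite !numden_Ratio ?mulr1 ?mulf_neq0 ?oner_neq0 //.
by apply/eqP; ring.
Qed.

End Embedding.

(** * Uniseriality, type and non-standardness of the twisted limit *)

Section Module.
Variables (W : Type) (lt : W -> W -> Prop).
Hypothesis om : is_omega1 lt.
Variables (R : idomainType) (r : W -> R) (J : QF R -> Prop) (e : W -> W -> R).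
Hypotheses (val : valuation_domain R) (pres : presents lt r J).
Hypothesis coh : coherent lt r e.
Variables (U : lmodType R) (a : W -> U).
Hypotheses (genU : forall u : U, exists s x, u = x *: a s)
  (annU : forall s x, x *: a s = 0 <-> exists c, x = c * r s)
  (linkU : forall t s k, lt t s -> r s = k * r t -> a t = (e s t * k) *: a s).

Let r0 s : r s != 0. Proof. by case: pres. Qed.
Let rdvd t s : lt t s -> exists c, r s = c * r t. Proof. by case: pres => _ [h _]; exact: h. Qed.

Lemma genU_above (u : U) s0 : exists s x, lt s0 s /\ u = x *: a s.
Proof.
have [s [x ->]] := genU u; have [t [st s0t]] := wsup2 om s s0.
have [k kE] := rdvd st; exists t, (x * (e t s * k)); split=> //.
by rewrite (linkU st kE) scalerA.
Qed.

(** Any two elements are multiples of a common generator [a t], and one of the two coefficients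
    divides the other. *)
Lemma twisted_uniserial : uniserial U.
Proof.
move=> V V' [_ [_ VZ]] [_ [_ V'Z]].
case: (pselect (forall x, V x -> V' x)) => [|/existsNP[v /not_implyP[Vv nV'v]]]; first by left.
right=> w V'w; have [s [x E]] := genU v; have [t [y [st F]]] := genU_above w s.
have [k kE] := rdvd st.
have {}E : v = (x * (e t s * k)) *: a t by rewrite E (linkU st kE) scalerA.
case: (valuation_dvd val (x * (e t s * k)) y) => -[c cE].
  by rewrite F cE -scalerA -E; exact: VZ.
by case: nV'v; rewrite E cE -scalerA -F; exact: V'Z.
Qed.

(** If [a0 = x *: a s] and [r s = z * x], then the annihilator of [a0] is [z R] and its [Dset] is
    [z J]; multiplication by [z] is the isomorphism. *)
Lemma twisted_type : has_type U J (@RinQ R).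
Proof.
case: coh => eu _; case: pres => _ [_ JE].
move=> a0 a0n0; have [s [x a0E]] := genU a0.
have nx : ~ exists c, x = c * r s by move=> /annU h; move: a0n0; rewrite a0E h eqxx.
have [z zE] : exists z, r s = z * x by case: (valuation_dvd val x (r s)).
have := r0 s; rewrite zE mulf_eq0 negb_or => /andP[z0 x0].
have nz : z \isn't a GRing.unit.
  by apply/negP => uz; apply: nx; exists z^-1; rewrite zE mulKr.
have kx0 t k : r t = k * r s -> k * x != 0.
  move=> kE; have := r0 t; rewrite kE zE !mulf_eq0 !negb_or => /andP[-> /andP[_ ->]] //.
exists (fun p y => J p /\ y = emb z * p); split; last split; last split; last split;
  last split; last split.
- move=> p y [Jp ->]; split=> //; have [t0 [b pE]] := (JE p).1 Jp.
  have [t [st t0t]] := wsup2 om s t0.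
  have [k kE] := rdvd st; have [l lE] := rdvd t0t.
  exists (k * x), (b * l); split; first exact: kx0 kE.
  split; first by exists (e t s *: a t); rewrite a0E (linkU st kE) !scalerA; congr (_ *: _); ring.
  have kn0 := kx0 _ _ kE.
  have lr : emb l * emb (r t0) = emb k * (emb z * emb x) by rewrite -!embM -lE kE zE.
  have kx := kn0; rewrite -emb_eq0 embM in kx.
  have rt0 : emb (r t0) != 0 by rewrite emb_eq0.
  rewrite pE !embM mulrA; apply/eqP; rewrite eqr_div //; apply/eqP.
  rewrite -[RHS]mulrA lr; ring.
- split; last by rewrite mulr0.
  by apply/JE; exists s, 0; rewrite emb0 mul0r.
- move=> p y p' y' [Jp ->] [Jp' ->]; split; last by rewrite mulrDr.
  have [t [b bE]] := (JE p).1 Jp; have [t' [b' b'E]] := (JE p').1 Jp'.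
  have [w [tw t'w]] := wsup2 om t t'.
  have [k kE] := rdvd tw; have [k' k'E] := rdvd t'w.
  apply/JE; exists w, (b * k + b' * k').
  have n1 : emb (r t) != 0 by rewrite emb_eq0.
  have n2 : emb (r t') != 0 by rewrite emb_eq0.
  have n3 : emb (r w) != 0 by rewrite emb_eq0.
  rewrite embD !embM mulrDl bE b'E; congr (_ + _).
    by apply/eqP; rewrite eqr_div // kE embM; apply/eqP; ring.
  by apply/eqP; rewrite eqr_div // k'E embM; apply/eqP; ring.
- move=> c p y [/JE[t [b ->]] ->]; split; last by rewrite mulrCA.
  by apply/JE; exists t, (c * b); rewrite embM mulrA.
- by move=> p Jp; exists (emb z * p).
- move=> y [q [s' [q0 [[u uE] ->]]]].
  have [t [w [st wE]]] := genU_above u s.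
  have [k kE] := rdvd st.
  have /annU[c cE] : (x * (e t s * k) - q * w) *: a t = 0.
    by rewrite scalerBl -!scalerA -wE -uE a0E (linkU st kE) -!scalerA subrr.
  (* Modulo the nonunit [z], [f] is congruent to the unit [e t s]. Then [q * w = k * x * f] shows
     that [q] divides [k * x], where [r t = z * (k * x)]. *)
  pose f := e t s - c * z.
  have uf : f \is a GRing.unit.
    apply: (eqm_nonunit val nz (eu _ _ st)); exists c; rewrite /f; ring.
  have E : q * w = k * x * f.
    have -> : q * w = x * (e t s * k) - (x * (e t s * k) - q * w) by ring.
    by rewrite cE kE zE /f; ring.
  have n1 : emb q != 0 by rewrite emb_eq0.
  have n2 : emb (r t) != 0 by rewrite emb_eq0.
  exists (emb (s' * w * f^-1) / emb (r t)); split; first by apply/JE; exists t, (s' * w * f^-1).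
  rewrite mulrA -embM; apply/eqP; rewrite eqr_div // -!embM; apply/eqP; congr emb.
  have -> : z * (s' * w / f) * q = z * s' * (q * w) / f by ring.
  by rewrite E mulrA mulrK // kE zE; ring.
- move=> p y [Jp ->]; split=> [[b ->]|[s' [sE]]].
    exists (z * b); rewrite embM; split=> //.
    by rewrite a0E scalerA; apply/annU; exists b; rewrite zE; ring.
  rewrite a0E scalerA => /annU[c cE]; exists c.
  have s'E : s' = c * z by apply: (mulIf x0); rewrite cE zE mulrA.
  have ez : emb z != 0 by rewrite emb_eq0.
  by apply: (mulfI ez); rewrite sE s'E embM mulrC.
Qed.

(** If [U] is [J'/A], lift each [a s] to [y s] in [J']. Each [r s * y s] with [r s] a nonunit
    generates [A]; comparing these generators with a fixed one gives units [d s] that trivialize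
    [e]. *)
Lemma twisted_nonstandard : ~ trivial_system lt r e -> ~ standard U.
Proof.
move=> ntriv [A [J' [[A0 [AD AZ]] [_ [_ [phi [_ [_ [pD [pZ [_ [psurj pA]]]]]]]]]]]].
apply: ntriv.
case: (pselect (exists s, r s \isn't a GRing.unit)) => [[s0 ns0]|allu]; last first.
  exists (fun=> 1); split=> [s|t s _]; first exact: unitr1.
  by apply: eqm_unit; apply: contrapT => /negP h; apply: allu; exists t.
have /choice[y yP] : forall s, exists y, phi y (a s) by move=> s; exact: psurj.
have AN x : A x -> A (- x).
  by move=> /(AZ (-1)); rewrite embN emb1 mulN1r.
have yA s x : A (emb x * y s) <-> exists c, x = c * r s.
  rewrite -annU; exact: (pA _ _ (pZ x _ _ (yP s))).
have nyA s : r s \isn't a GRing.unit -> ~ A (y s).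
  move=> ns; rewrite -[y s]mul1r -emb1 => /yA[c E].
  by move/negP: ns; apply; have := unitr1 R; rewrite E unitrM => /andP[].
have yn0 s : r s \isn't a GRing.unit -> y s != 0.
  by move=> /nyA; apply: contra_notN => /eqP->.
(* For r s a nonunit, A is generated by r s * y s: otherwise y s lies in A. *)
have AE s x : r s \isn't a GRing.unit -> A x -> exists c, x = emb (c * r s) * y s.
  move=> ns Ax; have yn := yn0 s ns.
  have [u [v [v0 E]]] := emb_frac (x / y s).
  have ev : emb v != 0 by rewrite emb_eq0.
  have {}E : emb v * x = emb u * y s.
    apply: (mulIf (invr_neq0 yn)); rewrite -mulrA E mulfK //.
    by rewrite mulrCA mulfV // mulr1.
  case: (valuation_dvd val v u) => -[c cE].
    have xE : x = emb c * y s.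
      by apply: (mulfI ev); rewrite E cE embM; ring.
    by move: Ax; rewrite xE => /yA[d ->]; exists d.
  case: (nyA s ns); have -> : y s = emb c * x; last exact: AZ.
  have u0 : emb u != 0.
    by rewrite emb_eq0; apply: contraNneq v0 => u0; rewrite cE u0 mulr0.
  by apply: (mulfI u0); rewrite -E cE embM; ring.
have gA s : A (emb (r s) * y s) by apply/yA; exists 1; rewrite mul1r.
have /choice[d dP] : forall s, exists c, c \is a GRing.unit /\
    (r s \isn't a GRing.unit -> emb (r s) * y s = emb c * (emb (r s0) * y s0)).
  (* If [r s] is a unit the value is arbitrary, since congruences modulo [r s] and its divisors are
     vacuous. *)
  move=> s; case: (boolP (r s \is a GRing.unit)) => us; first by exists 1; rewrite unitr1.
  have [c cE] := AE _ _ ns0 (gA s); have [c' c'E] := AE _ _ us (gA s0).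
  exists c; split=> [|_]; last by rewrite cE embM mulrA.
  have g0 : emb (r s0) * y s0 != 0 by rewrite mulf_neq0 ?emb_eq0 ?yn0.
  have : emb (c' * c) = emb 1.
    by apply: (mulIf g0); rewrite emb1 mul1r {2}c'E !embM -mulrA [emb (r s) * _]cE embM; ring.
  by move/emb_inj => cc; have := unitr1 R; rewrite -cc unitrM => /andP[].
exists d; split=> [s|t s ts]; first by have [] := dP s.
case: (boolP (r t \is a GRing.unit)) => ut; first exact: eqm_unit.
have [k kE] := rdvd ts.
have us : r s \isn't a GRing.unit.
  by apply: contra ut; rewrite kE unitrM => /andP[].
have [[udt /(_ ut) Et] [uds /(_ us) Es]] := (dP t, dP s).
(* Multiplied by [r t], this membership becomes the congruence of [d t] and [e s t * d s] modulo
   [r t]. *)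
have : A (y t - emb (e s t * k) * y s).
  have := pD _ _ _ _ (yP t) (pZ (- (e s t * k)) _ _ (yP s)).
  rewrite scaleNr -(linkU ts kE) subrr => /pA[_ /(_ erefl)].
  by rewrite embN mulNr.
move=> /(AE _ _ ns0)[c cE].
exists c; apply: emb_inj; rewrite embB !embM.
have g0 : emb (r s0) * y s0 != 0 by rewrite mulf_neq0 ?emb_eq0 ?yn0.
apply: (mulIf g0); rewrite mulrBl -Et -[_ * emb (d s) * _]mulrA -Es kE embM.
have -> : emb c * emb (r t) * (emb (r s0) * y s0) = emb (r t) * (emb (c * r s0) * y s0).
  by rewrite embM; ring.
by rewrite -cE embM; ring.
Qed.

End Module.

Lemma nonstandard_of_system (W : Type) (lt : W -> W -> Prop) (R : idomainType)
    (r : W -> R) (J : QF R -> Prop) (e : W -> W -> R) :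
  is_omega1 lt -> valuation_domain R -> presents lt r J ->
  coherent lt r e -> ~ trivial_system lt r e ->
  exists U : lmodType R, uniserial U /\ ~ standard U /\ has_type U J (@RinQ R).
Proof.
move=> om val pres coh ntriv; have [r0 [rdvd _]] := pres.
have [U [a [genU annU linkU]]] := twisted_limit om r0 rdvd coh.
exists U; split; first exact: (twisted_uniserial om val pres genU linkU).
split; first exact: (twisted_nonstandard val pres annU linkU ntriv).
exact: (twisted_type om val pres coh genU annU linkU).
Qed.

(** * Uncountable levels without CH *)

Section EssentiallyUncountable.
Variables (W : Type) (lt : W -> W -> Prop).
Hypothesis om : is_omega1 lt.
Variables (R : idomainType) (r : W -> R).
Hypothesis val : valuation_domain R.
Hypothesis rdvd : forall t s, lt t s -> exists c : R, r s = c * r t.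

(** For [s] below [t] and [r s] a nonunit, this says that (1 + r_s R)/(1 + r_t R) is countable. *)
Definition countable_step (s t : W) : Prop := exists w : nat -> R,
  forall x, x \is a GRing.unit -> eqm (r s) x 1 -> exists k, eqm (r t) x (w k).

Lemma countable_stepS s t s' t' : wle lt s s' -> wle lt t' t ->
  countable_step s t -> countable_step s' t'.
Proof.
move=> ss' tt' [w wP]; exists w => x ux xs.
have [k kP] := wP x ux (eqm_le rdvd ss' xs); exists k; exact: (eqm_le rdvd tt' kP).
Qed.

Variable f : R -> W.
Hypothesis f_inj : injective f.

(** The sets R_d of all [a] with [f a] below [d] are a filtration of [R] by countable sets; no unit
    multiple of [t] stays in R_d modulo every [r s]. *)
Definition avoids (d : W) (t : W -> R) : Prop := forall u, u \is a GRing.unit ->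
  exists s, lt s d /\ forall a, lt (f a) d -> ~ eqm (r s) (t s * u) a.

Local Notation U := (fun x : R => x \is a GRing.unit).

Fixpoint bin_prod (g : nat -> R) (x : nat -> bool) (n : nat) : R :=
  if n is m.+1 then bin_prod g x m * (if x m then g m else 1) else 1.

(* If every one of the 2^nat branches t * b^x were caught by some u_x, the map
   x |-> u_x would be injective, since no ratio of elements a with f a < d is
   congruent to the factor g_n on which two sequences first differ. *)
Lemma avoiding_branch d e t : ~ (exists i : (nat -> bool) -> W, injective i) ->
  is_limit lt d -> branch lt r U d e t ->
  (forall s, lt s d -> exists s', lt s s' /\ lt s' d /\ ~ countable_step s s') ->
  exists t', branch lt r U d e t' /\ avoids d t'.
Proof.
move=> nCH lim tB big.
have [_ tU _] := tB.
have [q [qd qsurj]] := seg_enum om lim.1.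
have [|s sP] := @increasing_seq _ lt om d (fun m m' => ~ countable_step m m') q qd.
  move=> m /big[m' [mm' [m'd nc]]]; exists m'; split=> //; split=> // k km; apply: contra_not nc.
  by apply: countable_stepS => //; right.
have sd n : lt (s n) d by have [] := sP n.
have sinc n : lt (s n) (s n.+1) by have [] := sP n.
have cof u : lt u d -> exists n, wle lt u (s n).
  by move=> /qsurj[n <-]; exists n; left; have [] := sP n.
have /choice[inv invP] : forall w, exists a, (exists a', f a' = w) -> f a = w.
  move=> w; case: (pselect (exists a', f a' = w)) => [[a' aE]|]; first by exists a'.
  by exists 0.
have invf a : inv (f a) = a by apply: f_inj; apply: invP; exists a.
have /choice[g gP] : forall n, exists g, [/\ g \is a GRing.unit, eqm (r (s n)) g 1
    & forall a a', lt (f a) d -> lt (f a') d -> ~ eqm (r (s n.+1)) g (a' / a)].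
  move=> n; have [_ _ _ nc] := sP n; apply: contrapT => ng; apply: nc.
  (* Only countably many ratios come from elements coded below [d]; if they met every class, the
     step would be countable. *)
  exists (fun k => if unpickle k is Some (i, j) then inv (q j) / inv (q i) else 0) => x ux x1.
  apply: contrapT => nk; apply: ng; exists x; split=> // a a' /qsurj[i iE] /qsurj[j jE] h.
  by apply: nk; exists (pickle (i, j)); rewrite pickleK iE jE !invf.
have bU x n : bin_prod g x n \is a GRing.unit.
  elim: n => [|n IH] /=; first exact: unitr1.
  by rewrite unitrM IH; case: (x n); rewrite ?unitr1 //; have [] := gP n.
have /choice[b bP] : forall x, exists b', conv_below lt r U d b' /\
    forall n u, wle lt u (s n) -> eqm (r u) (b' u) (bin_prod g x n).
  move=> x; apply: conv_of_seq => //= n.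
  rewrite -[X in eqm _ _ X]mulr1; apply: eqm_mull.
  by case: (x n); [have [] := gP n|exact: eqm_refl].
have /choice[t' t'P] : forall x, exists t', branch lt r U d e t' /\
    forall u, lt u d -> t' u = t u * b x u.
  move=> x; have [bx _] := bP x; exact: (branch_mul om (unit_unit_subgroup R) tB bx).
apply: contrapT => nav; apply: nCH.
have /choice[u uP] : forall x, exists u, u \is a GRing.unit /\
    forall v, lt v d -> exists a, lt (f a) d /\ eqm (r v) (t' x v * u) a.
  move=> x; apply: contrapT => nu; apply: nav; exists (t' x); split; first exact: (t'P x).1.
  move=> u uu; apply: contrapT => ns; apply: nu; exists u; split=> // v vd.
  by apply: contrapT => na; apply: ns; exists v; split=> // a ad h; apply: na; exists a.
exists (f \o u) => x y /f_inj uxy; apply: funext => n.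
suff agree m : forall k, (k < m)%N -> x k = y k by exact: (agree n.+1).
elim: m => // m IH k; rewrite ltnS leq_eqVlt => /orP[/eqP->{k}|/IH//].
have pE : bin_prod g x m = bin_prod g y m.
  elim: (m) IH => //= k IHk h; rewrite h // IHk // => l lk.
  by apply: h; rewrite ltnS ltnW.
clear IH n; wlog xy : x y pE uxy / x m = false /\ y m = true.
  case E : (x m); case F : (y m) => // h; rewrite -E -F; last exact: (h x y).
  by symmetry; apply: (h y x).
have {xy}[xm ym] := xy.
have [gu _ gn] := gP m.
have [a [ad aE]] := (uP x).2 _ (sd m.+1); have [a' [a'd a'E]] := (uP y).2 _ (sd m.+1).
case: (gn a a' ad a'd).
case: (boolP (r (s m.+1) \is a GRing.unit)) => ur; first exact: eqm_unit.
(* The values caught at level [s m.+1] are congruent to [z] for [x] and to [g m * z] for [y], so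
   [g m] is a ratio that its choice excluded. *)
have ux := (uP x).1; pose z := t (s m.+1) * bin_prod g x m * u x.
have az : eqm (r (s m.+1)) z a.
  apply: eqm_trans aE; rewrite (t'P x).2 //; apply: eqm_mulr; apply: eqm_mull; apply: eqm_sym.
  by have := (bP x).2 m.+1 _ (wle_refl lt _); rewrite /= xm mulr1.
have a'z : eqm (r (s m.+1)) (g m * z) a'.
  apply: eqm_trans a'E; rewrite (t'P y).2 // -uxy /z.
  have -> : g m * (t (s m.+1) * bin_prod g x m * u x) =
    t (s m.+1) * (bin_prod g y m * g m) * u x by rewrite pE; ring.
  apply: eqm_mulr; apply: eqm_mull; apply: eqm_sym.
  by have := (bP y).2 m.+1 _ (wle_refl lt _); rewrite /= ym.
have zu : z \is a GRing.unit by rewrite !unitrM ux bU !andbT; exact: tU.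
have au := eqm_nonunit val ur zu az.
apply: (eqm_cancel au); rewrite mulrCA divrr // mulr1.
apply: eqm_trans a'z; rewrite mulrC; apply: eqm_mull; exact: eqm_sym.
Qed.

(** Rows are chosen avoiding whenever some branch avoids. A trivialization [c] makes [e d s * c d]
    congruent to [c s], which is caught when [d] is closed under [f \o c]. *)
Lemma nontrivial_uncountable : ~ (exists i : (nat -> bool) -> W, injective i) ->
  (forall s, exists t, lt s t /\ ~ countable_step s t) ->
  exists e, coherent lt r e /\ ~ trivial_system lt r e.
Proof.
move=> nCH big.
have subU := unit_unit_subgroup R.
have [||e eP] := @wrec_choice _ lt om (W -> R) (fun=> 1) (fun d e t =>
    branch lt r U d e t /\ ((exists t', branch lt r U d e t' /\ avoids d t') -> avoids d t)).
- move=> d e e' t ee' [tB tA]; split; first exact: branch_local tB.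
  move=> [t' [t'B t'A]]; apply: tA; exists t'; split=> //.
  by apply: branch_local t'B => s sd; rewrite ee'.
- move=> d e he; have [t tB] := branch_exists om subU (fun s sd => (he s sd).1).
  case: (pselect (exists t', branch lt r U d e t' /\ avoids d t')) => [[t' [t'B t'A]]|nt].
    by exists t'; split.
  by exists t; split=> // /nt.
exists e; split; first exact: (branch_coherent subU (fun s => (eP s).1)).
move=> [c [cu cE]]; have /choice[nx nxP] := big.
have [w0] := w_inh om.
(* Closure under [nx] makes uncountable steps cofinal in [d], so that an avoiding branch exists
   there. *)
have [d [lim [_ cl]]] := closure_point om
  (fun n s => if n is 0%N then f (c s) else nx s) w0.
have [eB eA] := eP d.
have [|s [sd sA]] := eA _ (c d) (cu d).
  apply: (avoiding_branch nCH lim eB) => s sd; exists (nx s).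
  by have [h1 h2] := nxP s; split=> //; split=> //; exact: (cl s sd 1%N).
by apply: (sA (c s) (cl s sd 0%N)); apply: eqm_sym; exact: cE.
Qed.

End EssentiallyUncountable.

(** * Countable levels *)

Section CountableLevels.
Variables (W : Type) (lt : W -> W -> Prop).
Hypothesis om : is_omega1 lt.
Variables (R : idomainType) (r : W -> R).
Hypothesis rdvd : forall t s, lt t s -> exists c : R, r s = c * r t.
Variable K : R -> Prop.
Hypothesis subK : unit_subgroup K.
Hypothesis K_congr1 : forall s x, x \is a GRing.unit -> eqm (r s) x 1 -> K x.
Variable w : W -> nat -> R.
Hypothesis wK : forall s k, K (w s k).
Hypothesis w_surj : forall s x, K x -> exists k, eqm (r s) x (w s k).
Hypothesis infinite_step : forall t s, lt t s -> forall l : seq R, exists v,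
  [/\ v \is a GRing.unit, eqm (r t) v 1 & forall x, x \in l -> ~ eqm (r s) v x].

Definition far (s : W) (n : nat) (x : R) : Prop :=
  forall k, (k <= n)%N -> ~ eqm (r s) x (w s k).

Lemma far_eqm s n x y : eqm (r s) x y -> far s n x -> far s n y.
Proof. by move=> xy h k kn yk; apply: (h k kn); exact: eqm_trans yk. Qed.

Lemma far_le s m n x : (m <= n)%N -> far s n x -> far s m x.
Proof. by move=> mn h k km; apply: h; exact: leq_trans mn. Qed.

(* Finitely many nodes can be moved simultaneously above level s, up to level d,
   so as to stay far. *)
Definition extendible (d : W) (t : W -> R) : Prop := forall s, lt s d ->
  forall (us : seq R) n, (forall u, u \in us -> K u) -> exists v,
  [/\ v \is a GRing.unit, eqm (r s) v 1
    & forall u p, u \in us -> lt s p -> wle lt p d -> ~ is_limit lt p ->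
      far p n (t p * (u * v))].

(** [t p * u] is the predecessor at level [p] of the node [u] of level [d]. *)
Definition escapes (d : W) (t : W -> R) : Prop := forall u n, K u ->
  exists s, lt s d /\ forall p, lt s p -> lt p d -> ~ is_limit lt p -> far p n (t p * u).

Let K1 : K 1. Proof. by case: subK. Qed.
Let KM x y : K x -> K y -> K (x * y). Proof. by case: subK => _ h _ _; exact: h. Qed.
Let KV x : K x -> K x^-1. Proof. by case: subK => _ _ h _; exact: h. Qed.
Let Ku x : K x -> x \is a GRing.unit. Proof. by case: subK => _ _ _ h; exact: h. Qed.

Lemma extendible_zero d t : (forall s, ~ lt s d) -> extendible d t.
Proof. by move=> zero s sd; case: (zero s). Qed.

Lemma branch_link d e t s p : branch lt r K d e t -> e s s = 1 -> lt s d ->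
  wle lt p s -> eqm (r p) (t p) (t s * e s p).
Proof.
by move=> [_ _ tc] e1 sd [ps|->]; [exact: tc|rewrite e1 mulr1; exact: eqm_refl].
Qed.

(** Up to level [s], the predecessors of [u] along [t] are those of [t s * u] along [e s]. *)
Lemma extendible_branch d e t s : branch lt r K d e t -> e s s = 1 -> lt s d ->
  extendible s (e s) -> extendible s t.
Proof.
move=> tB e1 sd es p ps us n usK; have [_ tK _] := tB.
have [|v [uv v1 vP]] := es p ps [seq t s * u | u <- us] n.
  by move=> _ /mapP[u uus ->]; apply: KM; [exact: tK|exact: usK].
exists v; split=> // u q uus pq qs nl.
have := vP (t s * u) q (map_f _ uus) pq qs nl; apply: far_eqm.
have -> : e s q * (t s * u * v) = t s * e s q * (u * v) by ring.
by apply: eqm_mulr; apply: eqm_sym; exact: branch_link tB e1 sd qs.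
Qed.

(** Levels up to [s] are handled through [e s], the new level [d] by a further factor congruent to 1
    modulo [r s] that misses finitely many classes. *)
Lemma extendible_succ d t s e : branch lt r K d e t -> e s s = 1 -> lt s d ->
  (forall p, lt p d -> wle lt p s) -> extendible s (e s) -> extendible d t.
Proof.
move=> tB e1 sd smax es p pd us n usK; have [td tK _] := tB.
have [v [uv v1 vP]] : exists v, [/\ v \is a GRing.unit, eqm (r p) v 1
    & forall u q, u \in us -> lt p q -> wle lt q s -> ~ is_limit lt q ->
      far q n (t q * (u * v))].
  have [ps|->] := smax p pd; first exact: (extendible_branch tB e1 sd es ps).
  exists 1; split=> [||u q _ sq qs]; [exact: unitr1|exact: eqm_refl|].
  by case: (wltNge om sq qs).
have [v' [uv' v'1 v'P]] := infinite_step sd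
  [seq (u * v)^-1 * w d k | u <- us, k <- iota 0 n.+1].
exists (v * v'); split.
- by rewrite unitrM uv.
- rewrite -[X in eqm _ _ X]mul1r; apply: eqm_mul => //; exact: (eqm_le rdvd (smax p pd)).
- move=> u q uus pq qd nl; have uu := Ku (usK _ uus).
  case: qd => [/smax qs|->].
    apply: far_eqm (vP u q uus pq qs nl); apply: eqm_mull; rewrite mulrA.
    rewrite -[X in eqm _ X _]mulr1; apply: eqm_mull; apply: eqm_sym.
    exact: (eqm_le rdvd qs).
  rewrite td mul1r mulrA => k kn h.
  have uvu : u * v \is a GRing.unit by rewrite unitrM uu.
  apply: (v'P ((u * v)^-1 * w d k)).
    by apply/allpairsP; exists (u, k); split; rewrite ?mem_iota.
  by apply: (eqm_cancel uvu); rewrite mulVKr.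
Qed.

(** Fusion along a cofinal sequence. Stage [j] serves the request coded by [j]: a starting level,
    finitely many nodes and a bound. The moved nodes and [w d j] then join a list whose members are
    kept far, with growing bounds, at all later stages. *)
Lemma limit_step d e t : is_limit lt d -> branch lt r K d e t ->
  (forall s, lt s d -> e s s = 1 /\ extendible s (e s)) ->
  exists t', [/\ branch lt r K d e t', escapes d t' & extendible d t'].
Proof.
move=> lim tB ext; have [_ tK _] := tB.
have ext' s : lt s d -> extendible s t.
  by move=> sd; have [e1 es] := ext s sd; exact: extendible_branch tB e1 sd es.
have [q [qd qsurj]] := seg_enum om lim.1.
pose req j := odflt (0%N, [::], 0%N) (unpickle j : option (nat * seq nat * nat)).
pose sg j := q (req j).1.1; pose us j := map (w d) (req j).1.2; pose nn j := (req j).2.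
have usK j u : u \in us j -> K u by move=> /mapP[k _ ->]; exact: wK.
have [|s sP] := @increasing_seq _ lt om d (fun _ _ => True) sg (fun j => qd _).
  by move=> m /lim.2[m' [mm' m'd]]; exists m'.
have sd n : lt (s n) d by have [] := sP n.
have sinc n : lt (s n) (s n.+1) by have [] := sP n.
have sgs n : lt (sg n) (s n) by have [] := sP n.
have smono := seq_mono om sinc.
have cof u : lt u d -> exists n, wle lt u (s n).
  move=> /qsurj[n <-]; exists (pickle (n, [::] : seq nat, 0%N)); left.
  by have := sgs (pickle (n, [::] : seq nat, 0%N)); rewrite /sg /req pickleK.
(* A state consists of the partial product b, the nodes to be kept far, and the bound. *)
have [||S [_ SP]] := @dependent_choice_nat (R * seq R * nat)
  (fun j st => K st.1.1 /\ forall x, x \in st.1.2 -> K x)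
  (fun j st st' => exists v, [/\ v \is a GRing.unit, eqm (r (sg j)) v 1,
     forall u p, u \in us j -> lt (sg j) p -> wle lt p (s j) -> ~ is_limit lt p ->
       far p (nn j) (t p * (st.1.1 * (u * v)))
   & [/\ [/\ {subset st.1.2 <= st'.1.2}, w d j \in st'.1.2
          & forall u, u \in us j -> u * v \in st'.1.2],
         [/\ (st.2 <= st'.2)%N, (j <= st'.2)%N & (nn j <= st'.2)%N],
         eqm (r (s j)) st'.1.1 st.1.1
       & forall x p, x \in st'.1.2 -> lt (s j) p -> wle lt p (s j.+1) ->
           ~ is_limit lt p -> far p st'.2 (t p * (st'.1.1 * x))]])
  (1, [::], 0%N).
- by [].
- move=> j [[b L] N] /= [bK LK].
  (* [v] serves the request up to level [s j], modulo which the partial product [b] is already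
     final. *)
  have [|v [uv v1 vP]] := ext' _ (sd j) _ (sgs j) [seq b * u | u <- us j] (nn j).
    by move=> _ /mapP[u uus ->]; apply: KM => //; exact: usK uus.
  have vK := K_congr1 uv v1.
  pose L' := L ++ w d j :: [seq u * v | u <- us j].
  have L'K x : x \in L' -> K x.
    rewrite mem_cat inE => /orP[/LK//|/orP[/eqP->//|/mapP[u uus ->]]].
    by apply: KM => //; exact: usK uus.
  pose N' := (N + j + nn j)%N.
  (* [g] changes [b] only above [s j] and makes the whole enlarged list far up to [s j.+1]. *)
  have [|g [ug g1 gP]] := ext' _ (sd j.+1) _ (sinc j) [seq b * x | x <- L'] N'.
    by move=> _ /mapP[u uus ->]; apply: KM => //; exact: L'K.
  have gK := K_congr1 ug g1.
  exists (b * g, L', N'); split; first by split=> //=; exact: KM.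
  exists v; split=> //.
    by move=> u p uus h1 h2 h3; rewrite [b * _]mulrA; apply: vP => //; exact: map_f.
  split=> /=.
  + split=> [x xL||u uus]; rewrite mem_cat ?xL // inE ?eqxx ?orbT //.
    by rewrite (map_f (fun u => u * v) uus) !orbT.
  + by rewrite /N' -addnA leq_addr addnCA leq_addr addnA leq_addl.
  + by rewrite -[X in eqm _ _ X]mulr1; exact: eqm_mull.
  + by move=> x p xL h1 h2 h3; rewrite [b * g * _]mulrAC; apply: gP => //; exact: map_f.
have Kb n : K (S n).1.1 by have [[]] := SP n.
have [n|b [bc bE]] := @conv_of_seq _ lt om _ r rdvd K d s (fun n => (S n).1.1)
    sd sinc cof Kb.
  by have [_ [v [_ _ _ [_ _ h _]]]] := SP n.
have [t' [t'B t'E]] := branch_mul om subK tB bc.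
have Lmono m n : (m <= n)%N -> {subset (S m).1.2 <= (S n).1.2} /\ ((S m).2 <= (S n).2)%N.
  elim: n => [|n IH]; first by rewrite leqn0 => /eqP->; split.
  rewrite leq_eqVlt => /orP[/eqP->|]; first by split.
  rewrite ltnS => /IH[h1 h2].
  have [_ [v [_ _ _ [[h3 _ _] [h4 _ _] _ _]]]] := SP n.
  by split=> [x /h1/h3//|]; exact: (leq_trans h2 h4).
(* A nonlimit level [p] lies above some [s i] and at most at [s i.+1], where stage [i] took care of
   all nodes listed so far. *)
have late m x p : x \in (S m.+1).1.2 -> lt (s m) p -> lt p d -> ~ is_limit lt p ->
    far p (S m.+1).2 (t' p * x).
  move=> xm mp pd nl.
  have [i [mi ip pi]] : exists i, [/\ (m <= i)%N, lt (s i) p & wle lt p (s i.+1)].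
    have [n] := cof p pd; elim: n => [|n IH] pn.
      by case: (wltNge om (wle_lt_trans om (smono 0%N m isT) mp)).
    case: (wlt_or_ge om (s n) p) => [np|/IH//].
    exists n; split=> //; rewrite leqNgt; apply/negP => nm.
    by apply: (wltNge om mp); apply: (wle_trans om pn); exact: smono.
  have [h1 h2] := Lmono m.+1 i.+1 mi.
  have [_ [v [_ _ _ [_ _ _ h]]]] := SP i.
  apply: (far_le h2); apply: far_eqm (h x p (h1 _ xm) ip pi nl).
  rewrite t'E // mulrA; apply: eqm_mulr; apply: eqm_mull; apply: eqm_sym; exact: bE.
exists t'; split=> //.
- move=> u n uK; have [j ju] := w_surj d uK.
  pose m := maxn j n; exists (s m); split=> // p mp pd nl.
  have [_ [v [_ _ _ [[_ wj _] _ _ _]]]] := SP j.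
  have wm : w d j \in (S m.+1).1.2 by have [h _] := @Lmono j.+1 m.+1 (leq_maxl j n); exact: h.
  have [_ [v' [_ _ _ [_ [_ mS _] _ _]]]] := SP m.
  have nS : (n <= (S m.+1).2)%N by exact: leq_trans (leq_maxr j n) mS.
  apply: (far_le nS); apply: far_eqm (late _ _ _ wm mp pd nl); apply: eqm_mull.
  by apply: eqm_sym; apply: (eqm_le rdvd _ ju); left.
- move=> s0 s0d us0 n us0K.
  have /choice[k kP] : forall u, exists k, u \in us0 -> eqm (r d) u (w d k).
    move=> u; case: (boolP (u \in us0)) => [/us0K/(w_surj d)[k h]|_]; first by exists k.
    by exists 0%N.
  have [i iE] := qsurj _ s0d.
  pose j := pickle (i, map k us0, n).
  have rj : req j = (i, map k us0, n) by rewrite /req pickleK.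
  have sj : sg j = s0 by rewrite /sg rj.
  have nj : nn j = n by rewrite /nn rj.
  have [_ [v [uv v1 vP [[_ _ vL] [_ _ nS] _ _]]]] := SP j.
  rewrite sj in v1 vP; rewrite nj in vP nS.
  exists v; split=> // u p uus s0p pd nl.
  have {}pd : lt p d by case: pd => // pE; case: nl; rewrite pE.
  have uj : w d (k u) \in us j by rewrite /us rj /=; apply: map_f; exact: map_f.
  suff : far p n (t' p * (w d (k u) * v)).
    apply: far_eqm; apply: eqm_mull; apply: eqm_mulr; apply: eqm_sym.
    by apply: (eqm_le rdvd _ (kP _ uus)); left.
  (* Up to [s j] the factor [v] does the work, afterwards membership in the list. *)
  case: (wlt_or_ge om (s j) p) => [jp|pj]; first exact: far_le nS (late _ _ _ (vL _ uj) jp pd nl).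
  apply: far_eqm (vP _ _ uj s0p pj nl).
  rewrite t'E // mulrA; apply: eqm_mulr; apply: eqm_mull; apply: eqm_sym; exact: bE.
Qed.

(* Along a trivialization the levels where the k-th node (k <= n) is met would
   have no limit point, for every n, yet these sets exhaust the successors. *)
Lemma nontrivial_countable_levels (p : R) :
  (forall x, K x <-> x \is a GRing.unit /\ eqm p x 1) ->
  (forall s, exists c, r s = c * p) ->
  exists e, coherent lt r e /\ ~ trivial_system lt r e.
Proof.
move=> KE pr.
have [||e eP] := @wrec_choice _ lt om (W -> R) (fun=> 1) (fun d e t =>
    [/\ branch lt r K d e t, is_limit lt d -> escapes d t & extendible d t]).
- by move=> d e e' t ee' [tB tE tX]; split=> //; exact: branch_local tB.
- move=> d e he; have [t tB] := branch_exists om subK (fun s sd => let: And3 h _ _ := he s sd in h).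
  case: (wlimit_cases om d) => [zero|[[m [md mmax]]|lim]].
  + exists t; split=> //; last exact: extendible_zero.
    by case=> -[s sd]; case: (zero s).
  + exists t; have [[e1 _ _] _ mX] := he _ md; split=> //.
      case=> _ /(_ _ md)[m' [mm' /mmax]]; by case/(wltNge om).
    exact: extendible_succ tB e1 md mmax mX.
  + have [|t' [h1 h2 h3]] := limit_step lim tB; last by exists t'.
    by move=> s sd; have [[e1 _ _] _ eX] := he _ sd.
exists e; split.
  by apply: (branch_coherent subK) => s; have [] := eP s.
move=> [c [cu cE]]; have [w0] := w_inh om.
(* Dividing by [c w0] brings the trivialization into [K] above [w0]. *)
pose c' s := c s / c w0.
have c'E t s : lt t s -> eqm (r t) (c' t) (e s t * c' s).
  by move=> ts; rewrite /c' mulrA; apply: eqm_mulr; exact: cE.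
have c'K s : lt w0 s -> K (c' s).
  move=> ws; apply/KE; split; first by rewrite unitrM unitrV !cu.
  rewrite -(divrr (cu w0)); apply: eqm_mulr.
  have := eqm_dvd (pr w0) (cE _ _ ws); move/eqm_trans => /(_ (c s)) h; apply: eqm_sym; apply: h.
  rewrite -[X in eqm _ _ X]mul1r; apply: eqm_mulr.
  by have [[_ /(_ _ ws)/KE[]]] := eP s.
(* Otherwise the exceptional levels accumulate at some limit [d], although the row [e d] lets the
   node [c' d] escape. *)
have /choice[b bP] : forall n, exists b, forall q, lt b q -> ~ is_limit lt q -> far q n (c' q).
  move=> n; apply: contrapT => nb.
  have /choice[F FP] : forall b, exists q, [/\ lt b q, ~ is_limit lt q & ~ far q n (c' q)].
    move=> b; apply: contrapT => nq; apply: nb; exists b => q bq nl.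
    by apply: contrapT => nf; apply: nq; exists q.
  have [d [lim [w0d cl]]] := closure_point om (fun=> F) w0.
  have [_ /(_ lim) esc _] := eP d.
  have [s [sd sP]] := esc (c' d) n (c'K d w0d).
  have [sq nl nf] := FP s; apply: nf; have qd := cl s sd 0%N.
  by apply: far_eqm (sP _ sq qd nl); apply: eqm_sym; exact: c'E.
have [b0 b0P] := wsup_seq om b; have [b1 [b01 wb1]] := wsup2 om b0 w0.
(* The least [q] above [b1] is not a limit, and it exceeds [b k] even for the index [k] of the node
   [c' q]. *)
have [q [bq qmin]] : exists q, lt b1 q /\ forall p, lt p q -> ~ lt b1 p.
  by apply: (wlt_min om); have [q []] := wsup2 om b1 b1; exists q.
have nl : ~ is_limit lt q by move=> [_ /(_ _ bq)[v [bv /qmin]]].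
have [k kE] := w_surj q (c'K q (wlt_trans om wb1 bq)).
have bkq : lt (b k) q := wlt_trans om (wlt_trans om (b0P k) b01) bq.
exact: (bP k q bkq nl k (leqnn k) kE).
Qed.

End CountableLevels.

(** * Reduction to countable levels *)

Section EssentiallyCountable.
Variables (W : Type) (lt : W -> W -> Prop).
Hypothesis om : is_omega1 lt.
Variables (R : idomainType) (r : W -> R).
Hypothesis val : valuation_domain R.
Hypothesis rdvd : forall t s, lt t s -> exists c : R, r s = c * r t.
Hypothesis strict : forall s, exists t, lt s t /\ ~ exists c, r s = c * r t.

Definition avoiding_step (s t : W) : Prop := forall (l : seq R) v0,
  exists v, eqm (r s) v v0 /\ forall x, x \in l -> ~ eqm (r t) v x.

(** A strict step lets one element be avoided, by passing from [v0] to [v0 + r s] if necessary; a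
    list of length [n] takes [n] such steps. *)
Lemma eventually_avoiding s : exists b, forall t, lt b t -> avoiding_step s t.
Proof.
have fin n : forall s, exists t, forall (l : seq R) v0, size l = n ->
    exists v, eqm (r s) v v0 /\ forall x, x \in l -> ~ eqm (r t) v x.
  elim: n => [|n IH] {}s.
    by exists s => l v0 /size0nil->; exists v0; split=> //; exact: eqm_refl.
  have [t1 [st1 nst]] := strict s; have [t0 t0P] := IH t1.
  have [t [t1t t0t]] := wsup2 om t1 t0.
  exists t => -[//|x l] v0 [ls].
  have [v1 [v1s nv1]] : exists v1, eqm (r s) v1 v0 /\ ~ eqm (r t1) v1 x.
    case: (pselect (eqm (r t1) v0 x)) => h; last by exists v0; split=> //; exact: eqm_refl.
    exists (v0 + r s); split; first by exists 1; rewrite mul1r; ring.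
    move=> h'; apply: nst; have [c cE] := eqm_trans h' (eqm_sym h).
    by exists c; rewrite -cE; ring.
  have [v [vv1 vl]] := t0P l v1 ls; exists v; split.
    by apply: eqm_trans v1s; exact: (eqm_le rdvd (or_introl st1) vv1).
  move=> y; rewrite inE => /orP[/eqP->|yl] h.
    by apply: nv1; apply: (eqm_trans (eqm_sym vv1)); exact: (eqm_le rdvd (or_introl t1t) h).
  by apply: (vl y yl); exact: (eqm_le rdvd (or_introl t0t) h).
have /choice[t tP] := fun n => fin n s.
have [b bP] := wsup_seq om t; exists b => u bu l v0.
have [v [vv0 vl]] := tP _ l v0 erefl; exists v; split=> // x xl h.
by apply: (vl x xl); exact: (eqm_le rdvd (or_introl (wlt_trans om (bP _) bu)) h).
Qed.

(** The levels are thinned so that each step avoids finite lists. The units congruent to 1 modulo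
    [r s1] form the group [K], with countably many classes at each level. *)
Lemma nontrivial_countable : (exists s0, forall t, lt s0 t -> countable_step r s0 t) ->
  exists phi : W -> W, (forall s t, lt t s -> lt (phi t) (phi s)) /\
  exists e, coherent lt (r \o phi) e /\ ~ trivial_system lt (r \o phi) e.
Proof.
move=> [s0 s0P]; have [s1 [s01 ns]] := strict s0.
have nunit t : wle lt s1 t -> r t \isn't a GRing.unit.
  move=> s1t; apply/negP => ut; apply: ns; exists (r s0 / r s1).
  have u1 : r s1 \is a GRing.unit.
    by case: s1t => [/rdvd[c cE]|->//]; move: ut; rewrite cE unitrM => /andP[].
  by rewrite divrK.
have [||phi phiP] := @thinning _ lt om (fun t => lt s1 t) avoiding_step.
- by move=> s; have [t [h1 h2]] := wsup2 om s1 s; exists t.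
- exact: eventually_avoiding.
have s1phi s : lt s1 (phi s) by have [] := phiP s.
have pinc s t : lt t s -> lt (phi t) (phi s) by move=> ts; have [_ /(_ _ ts)[]] := phiP s.
exists phi; split=> //.
have pdvd t s : lt t s -> exists c, (r \o phi) s = c * (r \o phi) t.
  by move=> ts; apply: rdvd; exact: pinc.
pose K x := x \is a GRing.unit /\ eqm (r s1) x 1.
have subK : unit_subgroup K.
  split=> [|x y [ux x1] [uy y1]|x [ux x1]|x []//].
  - by split; [exact: unitr1|exact: eqm_refl].
  - split; first by rewrite unitrM ux.
    by rewrite -[X in eqm _ _ X]mulr1; exact: eqm_mul.
  - by split; [rewrite unitrV|exact: eqm_inv].
have /choice[w wP] : forall s, exists w : nat -> R, forall x, K x ->
    exists k, eqm (r (phi s)) x (w k).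
  move=> s; have [w wP] := s0P _ (wlt_trans om s01 (s1phi s)).
  by exists w => x [ux x1]; apply: wP => //; exact: (eqm_le rdvd (or_introl s01) x1).
have /choice[w' w'P] : forall s, exists w' : nat -> R, (forall k, K (w' k)) /\
    forall x, K x -> exists k, eqm (r (phi s)) x (w' k).
  move=> s; exists (fun k => if pselect (K (w s k)) then w s k else 1); split=> [k|x Kx].
    by case: pselect => // nK; case: subK.
  have [k kE] := wP s x Kx; exists k; case: pselect => // nK; case: nK.
  have [ux x1] := Kx; split.
    by apply: (eqm_nonunit val _ ux kE); apply: nunit; left.
  by apply: eqm_trans x1; apply: eqm_sym; exact: (eqm_le rdvd (or_introl (s1phi s)) kE).
apply: (@nontrivial_countable_levels _ lt om _ (r \o phi) pdvd K subK _ w' _ _ _ (r s1)) => //.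
- by move=> s x ux x1; split=> //; exact: (eqm_le rdvd (or_introl (s1phi s)) x1).
- by move=> s k; exact: (w'P s).1.
- by move=> s x; exact: (w'P s).2.
- move=> t s ts l; have [_ /(_ _ ts)[_ av]] := phiP s.
  have [v [v1 vl]] := av l 1; exists v; split=> //.
  by apply: (eqm_nonunit val _ (unitr1 R) (eqm_sym v1)); apply: nunit; left.
- by move=> s; exact: rdvd.
Qed.

End EssentiallyCountable.

(** * The weak diamond under CH *)

Lemma cantor_diagonal (T : Type) : ~ exists F : (T -> bool) -> T, injective F.
Proof.
move=> [F Finj]; pose D w := `[< exists2 x, F x = w & x w = false >].
case E : (D (F D)).
  by move/asboolP: (E) => [x /Finj ->]; rewrite E.
have : D (F D) by apply/asboolP; exists D.
by rewrite E.
Qed.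

Section WeakDiamond.
Variables (W : Type) (lt : W -> W -> Prop).
Hypothesis om : is_omega1 lt.

(** The range of [i] is uncountable, hence unbounded, and contains a strictly increasing sequence
    indexed by [W]. *)
Lemma real_code (i : (nat -> bool) -> W) : injective i ->
  exists j : W -> nat -> bool, injective j.
Proof.
move=> iinj.
have [||phi phiP] := @thinning _ lt om (fun t => exists x, i x = t) (fun _ _ => True).
- move=> s; apply: contrapT => ns.
  have [b [_ sb]] := wsup2 om s s; have [q qP] := wlt_seg om b.
  have ib x : exists n, q n = i x.
    apply: qP; case: (wlt_or_ge om s (i x)) => [sx|h]; last exact: (wle_lt_trans om h sb).
    by case: ns; exists (i x); split=> //; exists x.
  have /choice[F FP] := ib.
  by apply: (@cantor_diagonal nat); exists F => x y xy; apply: iinj; rewrite -!FP xy.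
- by move=> s; exists s.
have /choice[j jP] : forall s, exists x, i x = phi s by move=> s; have [] := phiP s.
exists j => s t st.
have E : phi s = phi t by rewrite -!jP st.
case: (wlt_total om s t) => [h|[//|h]].
  by have [_ /(_ _ h)[]] := phiP t; rewrite E => /(wlt_irr om).
by have [_ /(_ _ h)[]] := phiP s; rewrite E => /(wlt_irr om).
Qed.

Definition agree_below (X : Type) (d : W) (x y : W -> X) : Prop :=
  forall s, lt s d -> x s = y s.

(* A form of the Devlin-Shelah weak diamond, under CH.  If c existed, a family g
   of reals would be coded into a family H g such that, for d in C, the
   restrictions of g and H g to d determine g up to the next element of C.
   Iterating H, the countably many restrictions of the H^n g to min C determine g,
   so that W -> bool would inject into nat -> bool, hence into W. *)
Lemma weak_diamond (C : W -> Prop) (i : (nat -> bool) -> W) (X : Type) (f : X -> W)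
    (c : (W -> bool) -> W -> X) :
  cub lt C -> injective i -> injective f ->
  (forall d x y, C d -> agree_below d x y -> agree_below d (c x) (c y) -> x d = y d) ->
  False.
Proof.
move=> [unb clo] iinj finj det.
have [j jinj] := real_code iinj.
have /choice[nx nxP] : forall d, exists d', (C d' /\ lt d d') /\
    forall y, lt y d' -> ~ (C y /\ lt d y).
  by move=> d; apply: (wlt_min om); exact: unb.
have /choice[q qP] := wlt_seg om.
(* One real codes the restriction of [g] to the points below [s]. *)
pose cd s (g : W -> nat -> bool) (k : nat) : bool :=
  if (unpickle k : option (nat * nat)) is Some (n, m)
  then (if pselect (lt (q s n) s) then g (q s n) m else false) else false.
have cd_inj s g g' : cd s g = cd s g' -> agree_below s g g'.
  move=> E t ts; have [n nE] := qP s t ts; apply: funext => m.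
  have := congr1 (fun h => h (pickle (n, m))) E; rewrite /cd pickleK nE.
  by case: pselect.
have cd_ext s g g' : agree_below s g g' -> cd s g = cd s g'.
  move=> E; apply: funext => k; rewrite /cd; case: (unpickle k) => // -[n m].
  by case: pselect => // h; rewrite E.
(* The code of [g] up to the next point of [C] is split into its bits, so that [c] applies to each
   bit sequence. *)
pose bits (g : W -> nat -> bool) n d := cd (nx d) g n.
pose H (g : W -> nat -> bool) (s : W) (k : nat) : bool :=
  if (unpickle k : option (nat * nat)) is Some (n, m)
  then j (f (c (bits g n) s)) m else false.
have step d g g' : C d -> agree_below d g g' -> agree_below d (H g) (H g') ->
    agree_below (nx d) g g'.
  move=> Cd gg' HH; apply: cd_inj; apply: funext => n.
  apply: (det d (bits g n) (bits g' n) Cd) => [s sd|s sd].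
    rewrite /bits; congr (_ n); apply: cd_ext => t ts; apply: gg'.
    apply: (wlt_le_trans om ts); apply: (wleNgt om) => dn.
    by have [_ /(_ _ dn)] := nxP s; apply.
  apply: finj; apply: jinj; apply: funext => m.
  by have := congr1 (fun h => h (pickle (n, m))) (HH s sd); rewrite /H pickleK.
have [d0 [Cd0 d0min]] : exists d, C d /\ forall y, lt y d -> ~ C y.
  by apply: (wlt_min om); have [w0] := w_inh om; have [d []] := unb w0; exists d.
pose G x n := iter n H (fun s _ => x s).
(* One real records all iterates below the least point [d0] of [C]. *)
pose Th x (k : nat) : bool := if (unpickle k : option (nat * nat)) is Some (n, m)
  then cd d0 (G x n) m else false.
apply: (@cantor_diagonal W); exists (i \o Th) => x y /iinj E.
have base n : agree_below d0 (G x n) (G y n).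
  apply: cd_inj; apply: funext => m.
  by have := congr1 (fun h => h (pickle (n, m))) E; rewrite /Th pickleK.
suff all s : forall n, G x n s = G y n s.
  by apply: funext => s; have := congr1 (fun h => h 0%N) (all s 0%N).
move: s; apply: (well_founded_ind (wlt_wf om)) => s IH.
case: (wlt_or_ge om s d0) => [sd0 n|d0s]; first exact: base.
(* [d] is the last point of [C] at or below [s]; it lies in [C] because [C] is closed. *)
have [d [Cd ds sd]] : exists d, [/\ C d, wle lt d s & lt s (nx d)].
  have [d [[ds nC] dmin]] : exists d, (wle lt d s /\ forall y, C y -> lt d y -> ~ wle lt y s) /\
      forall y, lt y d -> ~ (wle lt y s /\ forall z, C z -> lt y z -> ~ wle lt z s).
    apply: (wlt_min om); exists s; split=> [|z _]; first exact: wle_refl.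
    exact: (wltNge om).
  have d0d : wle lt d0 d.
    by case: (wlt_or_ge om d d0) => // h; case: (nC d0 Cd0 h).
  have Cd : C d.
    apply: contrapT => nCd.
    have cof t : lt t d -> exists z, C z /\ lt t z /\ lt z d.
      move=> td; apply: contrapT => nt; apply: (dmin t td); split.
        by left; exact: (wlt_le_trans om td ds).
      move=> z Cz tz zs; apply: nt; exists z; split=> //; split=> //.
      case: (wlt_total om z d) => [//|[zd|dz]]; last by case: (nC z Cz dz).
      by case: nCd; rewrite -zd.
    have {}d0d : lt d0 d by case: d0d => // h; case: nCd; rewrite -h.
    by apply: nCd; apply: clo => //; split=> [|t /cof[z [_ h]]]; [exists d0|exists z].
  exists d; split=> //; have [[Cn dn] _] := nxP d.
  by case: (wlt_or_ge om s (nx d)) => // h; case: (nC _ Cn dn).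
move=> n; apply: (step d) => // t td; first exact: (IH _ (wlt_le_trans om td ds) n).
exact: (IH _ (wlt_le_trans om td ds) n.+1).
Qed.

End WeakDiamond.

(** * Incomplete levels and the construction under CH *)

Section Gamma.
Variables (W : Type) (lt : W -> W -> Prop).
Hypothesis om : is_omega1 lt.
Variables (R : idomainType) (r : W -> R).
Hypothesis val : valuation_domain R.
Hypothesis rdvd : forall t s, lt t s -> exists c : R, r s = c * r t.

Local Notation U := (fun x : R => x \is a GRing.unit).

(** If all later [r t] divided [r s], the topology at a level of the cub above [s] would be
    discrete, hence complete. *)
Lemma Gamma_strict : Gamma_is_one lt r ->
  forall s, exists t, lt s t /\ ~ exists c, r s = c * r t.
Proof.
move=> [C [[unb _] CG]] s; apply: contrapT => nt.
have [d [Cd sd]] := unb s; have [_ []] := CG d Cd.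
move=> u uC; have [N NP] := uC s sd; exists (u N) => t td; exists N => n Nn.
have h : eqm (r s) (u n) (u N) := NP n N Nn (leqnn N).
case: (wlt_or_ge om s t) => [st|ts]; last exact: (eqm_le rdvd ts h).
apply: eqm_dvd h; apply: contrapT => nc; apply: nt; exists t; split=> //.
Qed.

(** A Cauchy sequence without limit is translated to be congruent to 1 modulo a nonunit [r s1]; the
    values used are then units. *)
Lemma nonconvergent_units d : Gamma_set lt r d ->
  exists b, conv_below lt r U d b /\ forall x, ~ forall s, lt s d -> eqm (r s) (b s) x.
Proof.
move=> [lim inc].
have [u [uC nu]] : exists u, cauchy_below lt r d u /\ forall x, ~ converges_below lt r d u x.
  apply: contrapT => nu; apply: inc => u uC; apply: contrapT => nx; apply: nu.
  by exists u; split=> // x h; apply: nx; exists x.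
have [s1 [s1d ns1]] : exists s, lt s d /\ r s \isn't a GRing.unit.
  apply: contrapT => ns; apply: (nu 0) => s sd; exists 0%N => n _; apply: eqm_unit.
  by apply: contrapT => /negP h; apply: ns; exists s.
have /choice[N NP] : forall s, exists N, lt s d -> forall m n, (N <= m)%N -> (N <= n)%N ->
    eqm (r s) (u m) (u n).
  move=> s; case: (pselect (lt s d)) => [/uC[N NP]|]; first by exists N.
  by exists 0%N.
pose M s := maxn (N s) (N s1).
pose b s := 1 + u (M s) - u (N s1).
have eqmD s x y z : eqm (r s) x y -> eqm (r s) (1 + x - z) (1 + y - z).
  by case=> c E; exists c; rewrite -E; ring.
exists b; split; first split.
- move=> s sd; apply: (eqm_nonunit val ns1 (unitr1 R)); apply: eqm_sym.
  rewrite -[X in eqm _ _ X](addrK (u (N s1))); apply: eqmD.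
  by apply: NP => //; exact: leq_maxr.
- move=> t s ts sd; have td := wlt_trans om ts sd; apply: eqmD.
  apply: (@eqm_trans _ _ (u (maxn (M t) (M s)))).
    by apply: NP => //; [exact: leq_maxl|apply: leq_trans (leq_maxl _ _); exact: leq_maxl].
  apply: (eqm_le rdvd (or_introl ts)); apply: NP => //; last exact: leq_maxl.
  by apply: leq_trans (leq_maxr _ _); exact: leq_maxl.
- move=> x xP; apply: (nu (x - 1 + u (N s1))) => s sd; exists (M s) => n Mn.
  have h : eqm (r s) (u n) (u (M s)).
    by apply: NP => //; [apply: leq_trans Mn|]; exact: leq_maxl.
  have [c cE] := eqm_trans (eqmD _ _ _ (u (N s1)) h) (xP s sd).
  by exists c; rewrite -cE; ring.
Qed.

(** The second branch is the first times a nonconvergent family, which a common trivialization would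
    make converge to [x / y]. *)
Lemma two_branches d e t : branch lt r U d e t -> exists p : (W -> R) * (W -> R),
  [/\ branch lt r U d e p.1, branch lt r U d e p.2
    & Gamma_set lt r d -> forall x y, y \is a GRing.unit ->
      ~ forall s, lt s d -> eqm (r s) (p.1 s * x) (p.2 s * y)].
Proof.
move=> tB; case: (pselect (Gamma_set lt r d)) => [/nonconvergent_units[b [bc nb]]|nG];
  last by exists (t, t).
have [t' [t'B t'E]] := branch_mul om (unit_unit_subgroup R) tB bc.
exists (t, t'); split=> // _ x y uy /= h; apply: (nb (x / y)) => s sd.
have [_ /(_ s sd) tu _] := tB.
have := h s sd; rewrite t'E // -mulrA => /(eqm_cancel tu) /eqm_sym/(eqm_mulr y^-1).
by rewrite mulrK.
Qed.

(** Each [x : W -> bool] yields a system [E x] that picks one of two branches at [d] according to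
    [x d]. If all were trivial, [x] and its trivialization below [d] would determine [x d] for [d]
    in the cub, against the weak diamond. *)
Lemma nontrivial_CH (i : (nat -> bool) -> W) (f : R -> W) : injective i -> injective f ->
  Gamma_is_one lt r -> exists e, coherent lt r e /\ ~ trivial_system lt r e.
Proof.
move=> iinj finj [C [cubC CG]]; apply: contrapT => ne.
have triv e : coherent lt r e -> trivial_system lt r e.
  by move=> coh; apply: contrapT => nt; apply: ne; exists e.
have /choice[B BP] : forall de : W * (W -> W -> R), exists p : (W -> R) * (W -> R),
    (exists t, branch lt r U de.1 de.2 t) ->
    [/\ branch lt r U de.1 de.2 p.1, branch lt r U de.1 de.2 p.2
    & Gamma_set lt r de.1 -> forall x y, y \is a GRing.unit ->
      ~ forall s, lt s de.1 -> eqm (r s) (p.1 s * x) (p.2 s * y)].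
  move=> [d e] /=; case: (pselect (exists t, branch lt r U d e t)) => [[t]|nt].
    by move/two_branches => [p pP]; exists p.
  by exists (fun=> 1, fun=> 1) => /nt.
pose o : W -> R := fun=> 1.
have /choice[E EE] : forall x : W -> bool, exists e : W -> W -> R, forall s,
    e s = if x s then (B (s, restr lt o s e)).2 else (B (s, restr lt o s e)).1.
  by move=> x; exact: (wrec om o (fun s h => if x s then (B (s, h)).2 else (B (s, h)).1)).
have subU := unit_unit_subgroup R.
have ex_branch x d : (forall s, lt s d -> branch lt r U s (E x) (E x s)) ->
    exists t, branch lt r U d (restr lt o d (E x)) t.
  move=> /(branch_exists om subU)[t tB]; exists t; apply: branch_local tB => s sd.
  by rewrite restr_lt.
have EB x s : branch lt r U s (E x) (E x s).
  move: s; apply: (well_founded_ind (wlt_wf om)) => s IH.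
  apply: (@branch_local _ _ _ _ _ s (restr lt o s (E x))).
    by move=> t ts; rewrite restr_lt.
  have [h1 h2 _] := BP (s, restr lt o s (E x)) (ex_branch x s IH).
  by rewrite EE; case: (x s).
have Eloc d x y : agree_below lt d x y -> agree_below lt d (E x) (E y).
  move=> xy; apply: (well_founded_ind (wlt_wf om)) => s IH sd.
  rewrite !EE xy //; have -> // : restr lt o s (E x) = restr lt o s (E y).
  by apply: restr_eq => t ts; apply: IH => //; exact: (wlt_trans om ts sd).
have /choice[c cP] : forall x, exists c : W -> R, (forall s, c s \is a GRing.unit) /\
    (forall t s, lt t s -> eqm (r t) (c t) (E x s t * c s)).
  by move=> x; apply: triv; exact: (branch_coherent subU (EB x)).
apply: (weak_diamond om cubC iinj finj (c := c)) => d x y Cd.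
wlog xy : x y / x d = false /\ y d = true.
  move=> h xy cc; case Ex : (x d); case Ey : (y d) => //.
    by have := h y x (conj Ey Ex); rewrite Ex Ey => -> // s sd; rewrite ?xy ?cc.
  by have := h x y (conj Ex Ey); rewrite Ex Ey => ->.
have {xy}[xd yd] := xy; move=> xy cc.
have rE : restr lt o d (E x) = restr lt o d (E y) by apply: restr_eq; exact: Eloc.
have [_ _ /(_ (CG d Cd))] := BP (d, restr lt o d (E x)) (ex_branch x d (fun s _ => EB x s)).
move=> /(_ (c x d) (c y d) ((cP y).1 d)) []; move=> /= s sd.
have := (cP x).2 s d sd; rewrite EE xd => /eqm_sym/eqm_trans; apply.
by rewrite cc //; have := (cP y).2 s d sd; rewrite EE yd -rE.
Qed.

End Gamma.

(** * Combining the three cases *)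

Theorem mainTheorem12 :
  forall (W : Type) (lt : W -> W -> Prop), is_omega1 lt ->
  forall (R : idomainType), valuation_domain R ->
  (exists f : R -> W, bijective f) ->
  forall (J : QF R -> Prop), Qsubmod J -> (forall x, RinQ x -> J x) ->
  forall (r : W -> R), presents lt r J ->
  Gamma_is_one lt r ->
  exists U : lmodType R, uniserial U /\ ~ standard U /\ has_type U J (@RinQ R).
Proof.
move=> W lt om R val [f fbij] J _ _ r pres gam.
have finj := bij_inj fbij; have [r0 [rdvd JE]] := pres.
have [CH|nCH] := pselect (exists i : (nat -> bool) -> W, injective i).
  have [i iinj] := CH; have [e [coh nt]] := nontrivial_CH om val rdvd iinj finj gam.
  exact: nonstandard_of_system om val pres coh nt.
have [big|nbig] := pselect (forall s, exists t, lt s t /\ ~ countable_step r s t).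
  have [e [coh nt]] := nontrivial_uncountable om val rdvd finj nCH big.
  exact: nonstandard_of_system om val pres coh nt.
have [|phi [inc [e [coh nt]]]] :=
    nontrivial_countable om val rdvd (Gamma_strict om rdvd gam).
  move/existsNP: nbig => [s0 h]; exists s0 => t s0t; apply: contrapT => nc.
  by apply: h; exists t.
(* Reindexing along [phi] presents the same [J], because [s] is at most [phi s]. *)
apply: (nonstandard_of_system om val _ coh nt); split; first by move=> s; exact: r0.
split=> [t s ts|x]; first exact: rdvd (inc _ _ ts).
split=> [/JE[s [a ->]]|[s [a ->]]]; last by apply/JE; exists (phi s), a.
have [c cE] : exists c, r (phi s) = c * r s.
  by case: (increasing_ge om inc s) => [/rdvd//|<-]; exists 1; rewrite mul1r.
exists s, (a * c); have [n1 n2] : emb (r s) != 0 /\ emb (r (phi s)) != 0 by rewrite !emb_eq0 !r0.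
by apply/eqP; rewrite /= eqr_div // cE !embM; apply/eqP; ring.
Qed.
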